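(* There exists a separable, squat, non-metrisable surface $S$ such that for every compact subset $K\subset S$, the surface $S\setminus K$ does not admit a foliation (of dimension $1$).
   Context: Manifolds are Hausdorff, locally Euclidean spaces (not assumed metrisable or second countable), connected and without boundary unless otherwise indicated; an open subset such as $S\setminus K$ is treated as a (possibly disconnected) manifold. A surface is a $2$-dimensional manifold. A foliation (always of dimension $1$, topological) on an $n$-manifold $M$ is given by a maximal atlas of foliated charts $\varphi:U\to\mathbb R\times\mathbb R^{n-1}$ (homeomorphisms from open sets $U$ covering $M$ onto open boxes) whose coordinate changes are locally of the form $(x,y)\mapsto(f(x,y),g(y))$ with $y\in\mathbb R^{n-1}$. The closed long ray $\mathbb L_{\ge0}$ is $\omega_1\times[0,1)$ with the lexicographic order topology, and the open long ray is $\mathbb L_+=\mathbb L_{\ge0}\setminus\{0\}$, where $0$ denotes its least element. A space $X$ is squat if every continuous map $f:\mathbb L_+\to X$ is eventually constant, i.e. there is $\alpha\in\mathbb L_+$ such that $f$ is constant above $\alpha$. *)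

(* Defs.v *)
From HB Require Import structures.
From mathcomp Require Import all_boot all_order all_algebra.
From mathcomp Require Import all_classical all_reals all_analysis.
From mathcomp Require wochoice.

Set Implicit Arguments.
Unset Strict Implicit.
Unset Printing Implicit Defensive.

Import Order.TTheory GRing.Theory Num.Theory.
Import numFieldNormedType.Exports.

Local Open Scope classical_set_scope.
Local Open Scope ring_scope.

Definition homeomorphism_on (X Y : topologicalType) (U : set X) (V : set Y)
    (f : X -> Y) (g : Y -> X) : Prop :=
  [/\ (forall x, U x -> V (f x) /\ g (f x) = x),
      (forall y, V y -> U (g y) /\ f (g y) = y),
      {within U, continuous f} & {within V, continuous g}].

Definition locally_euclidean (R : realType) (n : nat) (M : topologicalType) :=
  forall x : M, exists (U : set M) (V : set 'rV[R]_n),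
    [/\ open U, U x, open V & exists f g, homeomorphism_on U V f g].

Definition manifold (R : realType) (n : nat) (M : topologicalType) : Prop :=
  [/\ hausdorff_space M, locally_euclidean R n M & connected [set: M]].

Definition surface (R : realType) (S : topologicalType) : Prop :=
  manifold R 2 S.

Definition metrisable (R : realType) (M : topologicalType) : Prop :=
  exists (N : metricType R) (f : M -> N) (g : N -> M),
    homeomorphism_on [set: M] [set: N] f g.

Definition separable (X : topologicalType) : Prop :=
  exists D : set X, countable D /\ dense D.

(* itv_open_ends also allows unbounded sides, such as the whole R x R^m. *)
Definition open_box (R : realType) (m : nat) (B : set (R * 'rV[R]_m)) : Prop :=
  exists (I : interval R) (J : 'I_m -> interval R),
    [/\ itv_open_ends I, (forall j, itv_open_ends (J j)) &
        B = [set p : R * 'rV[R]_m | p.1 \in I /\ forall j, p.2 0 j \in J j]].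

(* The values of chart_map outside chart_dom are irrelevant; a maximal atlas
   contains every extension of each of its charts. *)
Record chart (R : realType) (m : nat) (M : topologicalType) := Chart {
  chart_dom : set M ;
  chart_map :> M -> R * 'rV[R]_m }.

Definition foliated_chart (R : realType) (m : nat) (M : topologicalType)
    (c : chart R m M) : Prop :=
  open (chart_dom c) /\
  exists B, open_box B /\ exists g, homeomorphism_on (chart_dom c) B c g.

(* The coordinate change c' \o c^-1 has the form (x, y) |-> (f (x, y), g y) near
   every point c p with p in both (open) domains. *)
Definition foliated_change (R : realType) (m : nat) (M : topologicalType)
    (c c' : chart R m M) : Prop :=
  forall p, chart_dom c p -> chart_dom c' p ->
  exists (f : R * 'rV[R]_m -> R) (g : 'rV[R]_m -> 'rV[R]_m),
    \forall q \near p, c' q = (f (c q), g (c q).2).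

(* One-dimensional foliations of n-manifolds, for n >= 1. *)
Record foliation (R : realType) (n : nat) (M : topologicalType) := Foliation {
  atlas : set (chart R n.-1 M) ;
  atlas_chart : forall c, atlas c -> foliated_chart c ;
  atlas_cover : forall p : M, exists c, atlas c /\ chart_dom c p ;
  atlas_change : forall c c', atlas c -> atlas c' -> foliated_change c c' ;
  atlas_maximal : forall c, foliated_chart c ->
    (forall c', atlas c' -> foliated_change c c' /\ foliated_change c' c) ->
    atlas c }.

Definition admits_foliation (R : realType) (n : nat) (M : topologicalType) :=
  inhabited (foliation R n M).

Definition wo_le : rel (nat -> bool) :=
  sval (wochoice.well_ordering_principle (nat -> bool)).


Lemma wo_leP : wochoice.well_order wo_le.
Proof. by rewrite /wo_le; case: wochoice.well_ordering_principle. Qed.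

Lemma wo_le_min (A : set (nat -> bool)) : A !=set0 ->
  exists2 z, A z & forall x, A x -> wo_le z x.
Proof.
move=> [a Aa]; have [|z [[/set_mem Az zmin] _]] := wo_leP (A := mem A).
  by exists a; exact/mem_set.
by exists z => // x /mem_set /zmin.
Qed.

Lemma wo_le_total : total wo_le.
Proof.
move=> x y; have [|z [->|->] zmin] := @wo_le_min [set x; y].
- by exists x; left.
- by rewrite (zmin y)//; right.
- by rewrite (zmin x) ?orbT//; left.
Qed.

Lemma wo_le_refl : reflexive wo_le.
Proof. by move=> x; have := wo_le_total x x; rewrite orbb. Qed.

Lemma wo_le_anti : antisymmetric wo_le.
Proof.
move=> x y /andP[xy yx].
have [|z [_ zuniq]] := wo_leP (A := mem [set x; y]).
  by exists x; apply/mem_set; left.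
have min_of u v : wo_le u v -> [set x; y] = [set u; v] ->
    wochoice.minimum_of wo_le (mem [set x; y]) u.
  move=> uv ->; split; first by apply/mem_set; left.
  by move=> w /set_mem [] ->; rewrite ?wo_le_refl.
rewrite -(zuniq x) ?(zuniq y)//; first exact: (min_of y x yx (setUC _ _)).
exact: (min_of x y).
Qed.

Lemma wo_le_trans : transitive wo_le.
Proof.
move=> y x z xy yz; have [|w [[->|->]|->] wmin] := @wo_le_min [set x; y; z].
- by exists x; left; left.
- by apply: wmin; right.
- have yx : wo_le y x by apply: wmin; left; left.
  by rewrite (@wo_le_anti x y)// xy.
- have zy : wo_le z y by apply: wmin; left; right.
  by rewrite (@wo_le_anti z y) ?zy.
Qed.

(* The points with countably many predecessors in a well-ordering of an
   uncountable type form an initial segment of order type omega_1; this is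
   witnessed by omega1_wf, omega1_countable and omega1_uncountable below. *)
Definition omega1 := {x : nat -> bool | `[< countable [set y | wo_le y x] >]}.

HB.instance Definition _ := SubChoice.on omega1.

Definition omega1_le : rel omega1 := fun x y => wo_le (val x) (val y).

Lemma omega1_le_refl : reflexive omega1_le.
Proof. by move=> x; exact: wo_le_refl. Qed.

Lemma omega1_le_anti : antisymmetric omega1_le.
Proof. by move=> x y /wo_le_anti /val_inj. Qed.

Lemma omega1_le_trans : transitive omega1_le.
Proof. by move=> y x z; exact: wo_le_trans. Qed.

Lemma omega1_le_total : total omega1_le.
Proof. by move=> x y; exact: wo_le_total. Qed.

HB.instance Definition _ := Order.Le_isPOrder.Build
  Order.default_display omega1 omega1_le_refl omega1_le_anti omega1_le_trans.

HB.instance Definition _ := Order.POrder_isTotal.Build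
  Order.default_display omega1 omega1_le_total.

Lemma omega1_wf (A : set omega1) : A !=set0 ->
  exists2 z, A z & forall x, A x -> (z <= x)%O.
Proof.
move=> [a Aa]; have [|_ [z Az <-] zmin] := @wo_le_min (val @` A).
  by exists (val a), a.
by exists z => // x Ax; apply: zmin; exists x.
Qed.

Lemma omega1_countable (x : omega1) : countable [set y | (y <= x)%O].
Proof.
have /asboolP/countable_injP[f f_inj] := valP x.
apply/countable_injP; exists (f \o val) => y z yx zx /f_inj eq_yz.
by apply/val_inj/eq_yz; apply/mem_set; apply: set_mem; [exact: yx|exact: zx].
Qed.

Lemma omega1_uncountable : ~ countable [set: omega1].
Proof.
move=> cnt; pose A : set (nat -> bool) := val @` [set: omega1].
have cntA : countable A by apply: sub_countable cnt; exact: card_image_le.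
have inA x : countable [set y | wo_le y x] -> A x.
  by move=> cx; exists (Sub x (asboolT cx)).
have [AT|] := pselect (forall x, A x).
  have /countable_injP[h h_inj] := cntA.
  pose d n := ~~ `[< exists2 x, h x = n & x n >].
  case dE: (d (h d)); move: (dE); rewrite {1}/d.
    move=> /asboolP; apply; by exists d.
  move=> /negbFE/asboolP[x hx]; have -> : x = d; last by rewrite dE.
  by apply: h_inj => //; exact/mem_set.
move=> /existsNP/wo_le_min[z Az zmin]; apply: Az; apply: inA.
apply: (@sub_countable _ _ _ (A `|` [set z])).
  apply: subset_card_le => y yz /=; have [|/zmin zy] := pselect (A y); first by left.
  by right; apply: wo_le_anti; rewrite yz.
have -> : A `|` [set z] = \bigcup_(b in [set: bool]) (if b then A else [set z]).
  apply/seteqP; split=> y; first by case=> [Ay|yz]; [exists true|exists false].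
  by case=> -[] _; [left|right].
by apply: bigcup_countable => // -[] _; [exact: cntA|exact: countable1].
Qed.

Definition ico01 (R : realType) := {x : R | 0 <= x < 1}.

HB.instance Definition _ (R : realType) := SubChoice.on (ico01 R).
HB.instance Definition _ (R : realType) :=
  [SubChoice_isSubOrder of ico01 R by <: with Order.default_display].

Definition closed_long_ray (R : realType) : Type :=
  order_topology (omega1 *l ico01 R).

HB.instance Definition _ (R : realType) :=
  OrderTopological.on (closed_long_ray R).

(* As a set_type it carries the subspace topology. *)
Definition open_long_ray (R : realType) : Type :=
  [set x : closed_long_ray R | ~ forall y, (x <= y)%O].

HB.instance Definition _ (R : realType) := Topological.on (open_long_ray R).

Definition squat (R : realType) (X : topologicalType) : Prop :=
  forall f : open_long_ray R -> X, continuous f ->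
  exists a : open_long_ray R, forall x : open_long_ray R,
    (set_val a <= set_val x)%O -> f x = f a.

(* Main.v *)
Require Import Defs.
From HB Require Import structures.
From mathcomp Require Import finmap.
From mathcomp Require Import all_boot all_order all_algebra.
From mathcomp Require Import all_classical all_reals all_analysis.
From mathcomp Require Import lra ring.
Set Implicit Arguments. Unset Strict Implicit. Unset Printing Implicit Defensive.
Import Order.TTheory GRing.Theory Num.Theory.
Import numFieldNormedType.Exports.
Local Open Scope classical_set_scope.
Local Open Scope ring_scope.

(** The surface is a doubled Pruefer surface whose gluing varies from point to
    point. To the two open half-planes y <> 0 one adds, for each real x, a line
    of new points over (x, 0), one for each direction (t, 1) in which (x, 0) can
    be approached: near that line the coordinates (t, y) stand for the point (x
    + t * y, y) of the plane. The plane points with rational coordinates are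
    dense. The new points with t = 0 form an uncountable family in which each
    one has a neighbourhood free of the others, which a separable metric space
    does not allow. The surface is squat because the plane coordinates, and then
    the position on a single added line, are continuous real functions, and such
    functions are eventually constant on the long ray.

    These properties survive if the coordinates (t, y) at x are first changed by
    a homeomorphism [twist] of each half-plane, possibly as wild near y = 0 as
    the shear t |-> t + 1 - cos (1 / y). Three such modes are used: none, the
    shear, and the shear combined with a division of y by 1 + |t|. The core of
    the proof is [not_all_extend]: no foliation of the upper half-plane extends
    across the line at x in all three modes. Suppose it extends in the first
    one. A plaque of a chart is not contained in a compact subset of its domain,
    so the leaf through a point (0, 1 / s) with s large leaves the thin
    rectangle |t| <= d, |1 / y - s| <= 2 pi. If it leaves through the top or the
    bottom, then 1 / y runs through the neighbourhood of a multiple of 2 pi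
    while t stays near 0, and after the shear t goes from -k to 0 and back to -k
    for some fixed k > 0. If it leaves through a side, then y has changed little
    but t has moved by d, so that y * (1 + |t|), which is the second coordinate
    in the third mode, does the same as y above, and there the zigzag appears.
    Such a zigzag, arbitrarily close to the axis, cannot lie in a plaque of a
    foliated chart around the origin ([no_zigzag]): the parameter along the
    plaque is monotone, but its values at the two ends agree in the limit and
    differ from the value in the middle.

    The modes are chosen by diagonalisation. A foliation of an open part of the
    upper half-plane is determined by a set of countably many yes-no data
    ([coded_levels]), so pairs of a code C and a natural number k embed in the
    real line ([code_point_inj]). At the point x with index (C, k) the mode is
    one in which C does not extend. If the complement of a compact set K had a
    foliation, with code C, then for some k the new point with t = 0 over the x
    of index (C, k) would lie outside K, since K contains only finitely many
    such points ([compact_misses_axis]), and there the foliation would extend C. *)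

(** * Real functions and paths *)

Section paths.
Variable R : realType.
Implicit Types (f : R -> R) (a b c : R).

Lemma continuous_nbhs_lt f a c : {for a, continuous f} -> f a < c ->
  exists2 e, 0 < e & forall x, `|x - a| < e -> f x < c.
Proof.
move=> fa fac.
have /nbhs_ballP[e /= e0 He] := fa [set y | y < c] (open_nbhs_nbhs (conj (@open_lt R c) fac)).
by exists e => // x xa; apply: He; rewrite /ball /= distrC.
Qed.

(** The infimum of the parameters where [f] is at least [c] is such an [r]. *)
Lemma first_crossing f a b c : continuous f -> a <= b -> f a <= c -> c <= f b ->
  exists r, [/\ a <= r <= b, f r = c & forall s, a <= s <= r -> f s <= c].
Proof.
move=> cf ab fac cfb; pose A := [set s | a <= s <= b /\ c <= f s].
have Ab : A b by split => //; rewrite ab lexx.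
have lbA : lbound A a by move=> s [/andP[]].
have hA : has_inf A by split; [exists b|exists a].
pose r := inf A.
have ar : a <= r by apply: lb_le_inf => //; exists b.
have rle s : A s -> r <= s by move=> As; apply: ge_inf => //; exists a.
have cfr : c <= f r.
  rewrite leNgt; apply/negP => frc.
  have [e e0 He] := continuous_nbhs_lt (cf r) frc.
  have [s As sr] := inf_adherent e0 hA.
  have := As.2; apply/negP; rewrite -ltNge; apply: He.
  by rewrite ger0_norm ?subr_ge0 ?rle// ltrBlDl.
have below s : a <= s -> s < r -> f s < c.
  move=> as_ sr; rewrite ltNge; apply/negP => cfs.
  have : A s by split => //; rewrite as_ (le_trans (ltW sr))// rle.
  by move/rle; rewrite leNgt sr.
have frc : f r <= c.
  rewrite leNgt; apply/negP => cltfr.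
  have [||s /[!in_itv]/= /andP[as_ sr] fs] := @IVT R f a r c ar.
  - exact: continuous_subspaceT.
  - by rewrite ge_min fac le_max cfr orbT.
  move: sr; rewrite le_eqVlt => /orP[/eqP sr|/(below _ as_)]; last by rewrite fs ltxx.
  by move: cltfr; rewrite -sr fs ltxx.
exists r; split; first by rewrite ar rle.
  by apply/eqP; rewrite eq_le frc cfr.
move=> s /andP[as_]; rewrite le_eqVlt => /orP[/eqP->//|/(below _ as_)/ltW//].
Qed.

(** The upper end is the first crossing of [M]; the lower end is the last
    crossing of [L] before it, found by running time backwards. *)
Lemma crossing f a b L M : continuous f -> a <= b -> L < M -> f a <= L ->
  M <= f b ->
  exists p q, [/\ a <= p, p < q, q <= b, f p = L /\ f q = M &
    forall s, p <= s <= q -> L <= f s <= M].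
Proof.
move=> cf ab LM faL Mfb.
have [q [/andP[aq qb] fq qle]] := first_crossing cf ab (le_trans faL (ltW LM)) Mfb.
have cg : continuous (fun s => - f (- s)).
  move=> s; apply: continuousN; apply: continuous_comp; first exact: opp_continuous.
  exact: cf.
have [|||p [/andP[qp pa] fp ple]] := @first_crossing _ (- q) (- a) (- L) cg.
- by rewrite lerN2.
- by rewrite opprK fq lerN2 ltW.
- by rewrite opprK lerN2.
have pq : - p < q.
  rewrite lt_neqAle lerNl qp andbT; apply/eqP => pq.
  by move: fp; rewrite pq fq => /oppr_inj ML; rewrite ML ltxx in LM.
exists (- p), q; split => //; first by rewrite lerNr.
  by split=> //; apply: oppr_inj.
move=> s /andP[ps sq]; rewrite (qle s) ?sq ?andbT ?(le_trans _ ps)// 1?lerNr//.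
have : - q <= - s <= p by rewrite lerN2 sq lerNl.
by move=> /ple; rewrite opprK lerN2.
Qed.

(** The ends of the excursion are interchangeable in what follows, so both
    directions of crossing are treated at once. *)
Lemma crossing3 f a b L m M : continuous f -> a <= b -> L < m -> m < M ->
  (f a <= L /\ M <= f b) \/ (M <= f a /\ f b <= L) ->
  exists p r q, [/\ a <= p, q <= b, p < r < q,
    [/\ f p = L \/ f p = M, f r = m & f q = L \/ f q = M] &
    forall s, p <= s <= q -> L <= f s <= M].
Proof.
move=> cf ab Lm mM H; have LM := lt_trans Lm mM.
have mid p q : p < q -> (f p = L /\ f q = M) \/ (f p = M /\ f q = L) ->
    exists2 r, p < r < q & f r = m.
  move=> pq fpq; have [||r /[!in_itv]/= /andP[pr rq] fr] := @IVT R f p q m (ltW pq).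
  - exact: continuous_subspaceT.
  - by case: fpq => -[-> ->]; rewrite ge_min le_max (ltW Lm) (ltW mM) ?orbT.
  exists r => //; rewrite !lt_neqAle pr rq !andbT; apply/andP; split; apply/eqP => E.
    by move: fr fpq; rewrite -E => -> [][E1 E2]; lra.
  by move: fr fpq; rewrite E => -> [][E1 E2]; lra.
case: H => [[fa fb]|[fa fb]].
  have [p [q [ap pq qb [fp fq] pqle]]] := crossing cf ab LM fa fb.
  have [|r prq fr] := mid p q pq; first by left.
  by exists p, r, q; split => //; split; auto.
have cg : continuous (fun s => - f s) by move=> s; apply: continuousN; exact: cf.
have [|||p [q [ap pq qb [fp fq] pqle]]] := @crossing _ a b (- M) (- L) cg ab.
- by rewrite ltrN2.
- by rewrite lerN2.
- by rewrite lerN2.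
have {}fp : f p = M by apply: oppr_inj.
have {}fq : f q = L by apply: oppr_inj.
have [|r prq fr] := mid p q pq; first by right.
exists p, r, q; split => //; first by split; auto.
by move=> s /pqle; rewrite !lerN2 andbC.
Qed.

Lemma locally_constant f : (forall r, \forall s \near r, f s = f r) ->
  forall r s, f r = f s.
Proof.
move=> lc r s; apply: is_derive_0_is_cst => x.
have E : \forall y \near x, f y = cst (f x) y by exact: lc.
have := @is_derive_cst R R^o R^o (f x) x 1.
by apply: near_eq_is_derive; apply: filterS E => y ->.
Qed.

(** Composition with [clamp a b] replaces a path on [a, b] by one that is
    defined and continuous on the whole line and has the same image; this
    removes domain conditions from all statements about paths. *)
Definition clamp a b r := Num.max a (Num.min r b).

Lemma clamp_continuous a b : continuous (clamp a b).
Proof.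
move=> r; apply: (@continuous_max R R (cst a) (fun r => Num.min r b)).
  exact: cst_continuous.
by apply: (@continuous_min R R id (cst b)); [exact: cvg_id|exact: cst_continuous].
Qed.

Lemma clamp_itv a b r : a <= b -> a <= clamp a b r <= b.
Proof. by move=> ab; rewrite /clamp le_max lexx /= ge_max ab ge_min lexx orbT. Qed.

Lemma clamp_id a b r : a <= r <= b -> clamp a b r = r.
Proof. by move=> /andP[ar rb]; rewrite /clamp min_l// max_r. Qed.

Lemma injective_monotone f a b : continuous f ->
  (forall r s, a <= r <= b -> a <= s <= b -> f r = f s -> r = s) ->
  forall p r q, a <= p -> p < r -> r < q -> q <= b ->
  (f p < f r < f q) \/ (f q < f r < f p).
Proof.
move=> cf finj p r q ap pr rq qb.
have cf' : {within [set` `[a, b]], continuous f} by exact: continuous_subspaceT.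
have finj' : {in `[a, b] &, injective f}.
  by move=> x y; rewrite !in_itv/=; exact: finj.
have pin : p \in `[a, b] by rewrite in_itv/= ap /= ltW// (lt_trans pr)// (lt_le_trans rq).
have rin : r \in `[a, b].
  by rewrite in_itv/= (ltW (le_lt_trans ap pr)) ltW// (lt_le_trans rq).
have qin : q \in `[a, b].
  by rewrite in_itv/= qb andbT ltW// (le_lt_trans ap)// (lt_trans pr).
have [inc|dec] := itv_continuous_inj_mono cf' finj'.
  by left; rewrite !inc.
by right; rewrite !dec.
Qed.

End paths.

(** * Boxes in the plane and foliated charts on them *)

Section plane.
Variable R : realType.
Local Notation plane := (R * R)%type.

Definition square (z : plane) (e : R) : set plane :=
  [set p | `|p.1 - z.1| < e /\ `|p.2 - z.2| < e].

Lemma square_ball z e : square z e = ball z e.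
Proof.
have E (x y : R) : ball x e y = (`|y - x| < e) :> Prop by rewrite -ball_normE /= distrC.
by apply/seteqP; split=> p [h1 h2]; split; move: h1 h2; rewrite ?E// -?E.
Qed.

Lemma nbhs_squareP (z : plane) (W : set plane) :
  nbhs z W <-> exists2 e, 0 < e & square z e `<=` W.
Proof.
split=> [/nbhs_ballP[e e0 zeW]|[e e0 zeW]]; last apply/nbhs_ballP.
  by exists e => //; rewrite square_ball.
by exists e => //; rewrite -square_ball.
Qed.

Lemma square_open z e : open (square z e).
Proof.
rewrite openE => p [p1 p2]; apply/nbhs_squareP.
exists (Num.min (e - `|p.1 - z.1|) (e - `|p.2 - z.2|)).
  by rewrite lt_min !subr_gt0 p1 p2.
move=> q [] /=; rewrite !lt_min => /andP[q1 _] /andP[_ q2]; split.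
  by rewrite -(subrKA p.1) (le_lt_trans (ler_normD _ _))// -ltrBrDr.
by rewrite -(subrKA p.2) (le_lt_trans (ler_normD _ _))// -ltrBrDr.
Qed.

Lemma square_center z e : 0 < e -> square z e z.
Proof. by move=> e0; rewrite /square /= !subrr normr0. Qed.

Lemma pair_continuous (T : topologicalType) (f g : T -> R) (x : T) :
  {for x, continuous f} -> {for x, continuous g} ->
  {for x, continuous (fun y => (f y, g y))}.
Proof.
move=> cf cg; rewrite /prop_for /continuous_at.
exact: (@cvg_pair _ _ _ (nbhs x) (nbhs (f x)) (nbhs (g x)) _ _ _ f g cf cg).
Qed.

Lemma fst_continuous (x : plane) : {for x, continuous (@fst R R)}.
Proof. exact: cvg_fst. Qed.

Lemma snd_continuous (x : plane) : {for x, continuous (@snd R R)}.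
Proof. exact: cvg_snd. Qed.

(** A chart onto an open square, whose second coordinate is constant along
    plaques.  Being onto a square is what makes plaques open segments. *)
Definition box_chart (N : set plane) (c : plane -> plane) : Prop :=
  [/\ open N, (forall q, N q -> {for q, continuous c}) &
      exists g z r, [/\ 0 < r,
        (forall q, N q -> square z r (c q) /\ g (c q) = q),
        (forall p, square z r p -> N (g p) /\ c (g p) = p) &
        (forall p, square z r p -> {for p, continuous g})]].

Lemma box_chart_inj N c q q' : box_chart N c -> N q -> N q' -> c q = c q' -> q = q'.
Proof.
move=> [_ _ [g [z [r [_ gK _ _]]]]] /gK[_ E] /gK[_ E'] cE.
by rewrite -E -E' cE.
Qed.

(** On the compact set [T] the parameter of the plaque has a maximum, and the
    plaque goes on beyond it. *)
Lemma plaque_exit N c q0 (T : set plane) : box_chart N c -> compact T ->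
  T `<=` N -> T q0 ->
  exists (gam : R -> plane) a b, [/\ continuous gam, a <= b /\ (forall r, N (gam r)),
    (forall r, (c (gam r)).2 = (c q0).2),
    (forall r, a <= r <= b -> (c (gam r)).1 = r) &
    gam a = q0 /\ ~ T (gam b)].
Proof.
move=> [oN cc [g [z [e [e0 gK cK cg]]]]] cT TN Tq0.
have [||m /set_mem Tm mmax] := @compact_EVT_max _ R (fst \o c) T _ cT.
- by exists q0.
- apply: continuous_in_subspaceT => q /set_mem /TN /cc qc.
  by apply: continuous_comp; [exact: qc|exact: fst_continuous].
have [[m1 m2] _] := gK _ (TN _ Tm).
have [[q1 q2] gq] := gK _ (TN _ Tq0).
(* Halfway between the largest parameter on T and the end of the plaque. *)
pose a := (c q0).1; pose b := ((c m).1 + (z.1 + e)) / 2.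
have mb : (c m).1 < b.
  by move: m1; rewrite /b ltr_norml => /andP[_]; lra.
have be : b < z.1 + e by move: m1; rewrite /b ltr_norml => /andP[_]; lra.
have am : a <= (c m).1 by apply: mmax; apply/mem_set.
have ab : a <= b by exact: le_trans (ltW mb).
have sqr r : a <= r <= b -> square z e (r, (c q0).2).
  move=> /andP[ar rb]; split => //=; move: q1; rewrite !ltr_norml /a in ar * => /andP[h _].
  by apply/andP; split; lra.
pose gam r := g (clamp a b r, (c q0).2).
have cl r : square z e (clamp a b r, (c q0).2) by apply: sqr; exact: clamp_itv.
exists gam, a, b; split.
- move=> r; apply: (@continuous_comp _ _ _ (fun r => (clamp a b r, (c q0).2)) g); last exact: cg.
  by apply: pair_continuous; [exact: clamp_continuous|exact: cst_continuous].
- by split => // r; have [] := cK _ (cl r).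
- by move=> r; have [_ ->] := cK _ (cl r).
- by move=> r rab; have [_ ->] := cK _ (cl r); rewrite clamp_id.
- rewrite /gam !clamp_id ?lexx ?ab// /a -surjective_pairing; split => // Tb.
  have := mmax _ (mem_set Tb); rewrite /= (cK _ (sqr b _)).2 /=; last by rewrite ab lexx.
  by rewrite leNgt mb.
Qed.

End plane.

(** * Codes of foliations by rational data *)

Section codes.
Variable R : realType.
Local Notation plane := (R * R)%type.

Definition ratpt (p : rat * rat) : plane := (ratr p.1, ratr p.2).

Definition ratbox (b : rat * rat * rat) : set plane :=
  square (ratpt b.1) (ratr b.2).

Lemma ratpt_dense (p : plane) W : nbhs p W -> exists q, W (ratpt q).
Proof.
move=> /nbhs_squareP[e e0 sW].
have [q1 /[!in_itv]/= /andP[l1 r1]] : exists q : rat, ratr q \in `]p.1, (p.1 + e)[.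
  by apply: rat_in_itvoo; rewrite ltrDl.
have [q2 /[!in_itv]/= /andP[l2 r2]] : exists q : rat, ratr q \in `]p.2, (p.2 + e)[.
  by apply: rat_in_itvoo; rewrite ltrDl.
exists (q1, q2); apply: sW; rewrite /square /= !ger0_norm ?subr_ge0 ?ltW//.
by rewrite !ltrBlDl.
Qed.

Lemma ratbox_basis (p : plane) W : nbhs p W ->
  exists2 b, ratbox b p & ratbox b `<=` W.
Proof.
move=> /nbhs_squareP[e e0 sW].
have [d /[!in_itv]/= /andP[d0 de]] : exists q : rat, ratr q \in `]0 : R, (e / 2)[.
  by apply: rat_in_itvoo; rewrite divr_gt0.
have [q [/= h1 h2]] := ratpt_dense (open_nbhs_nbhs (conj (@square_open _ p (ratr d)) (square_center p d0))).
exists (q, d).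
  by split => /=; rewrite distrC.
move=> p' [/= k1 k2]; apply: sW; split.
  by rewrite -(subrKA (ratr q.1)) (le_lt_trans (ler_normD _ _))//; lra.
by rewrite -(subrKA (ratr q.2)) (le_lt_trans (ler_normD _ _))//; lra.
Qed.

(** An index (b, p1, p2) stands for the question whether the point [p1] of the
    box [b] is at most as high as [p2], in a chart of the foliation on [b]. *)
Definition code_index : Type := (rat * rat * rat) * (rat * rat) * (rat * rat).

Definition coded (C : set code_index) b (w : plane -> R) :=
  forall p1 p2, ratbox b (ratpt p1) -> ratbox b (ratpt p2) ->
    (C (b, p1, p2) <-> w (ratpt p1) <= w (ratpt p2)).

(** The second coordinate of a foliated chart is continuous and open; openness
    is used in the form that it has no local extremum. *)
Definition no_extremum (B : set plane) (w : plane -> R) :=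
  forall p, B p -> {for p, continuous w} /\
    forall W, nbhs p W -> (exists2 p', W p' & w p < w p') /\ (exists2 p', W p' & w p' < w p).

Lemma cvg_above (T : topologicalType) (w : T -> R) p a : {for p, continuous w} -> a < w p ->
  \forall x \near p, a < w x.
Proof. by move=> cw ap; exact: (cw _ (open_nbhs_nbhs (conj (@open_gt R a) ap))). Qed.

Lemma cvg_below (T : topologicalType) (w : T -> R) p a : {for p, continuous w} -> w p < a ->
  \forall x \near p, w x < a.
Proof. by move=> cw ap; exact: (cw _ (open_nbhs_nbhs (conj (@open_lt R a) ap))). Qed.

Lemma nbhs_ratbox b p : ratbox b p -> nbhs p (ratbox b).
Proof. by move=> bp; apply: open_nbhs_nbhs; split => //; exact: square_open. Qed.

Lemma no_extremum_ratpt b w p W : no_extremum (ratbox b) w -> ratbox b p ->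
  nbhs p W ->
  (exists q, [/\ ratbox b (ratpt q), W (ratpt q) & w p < w (ratpt q)]) /\
  (exists q, [/\ ratbox b (ratpt q), W (ratpt q) & w (ratpt q) < w p]).
Proof.
move=> nw bp pW; pose W1 := (ratbox b `&` W)^°.
have pW1 : nbhs p W1 by apply: nbhs_interior; apply: filterI => //; exact: nbhs_ratbox.
have [_ /(_ _ pW1)[[x W1x px] [y W1y yp]]] := nw _ bp; split.
  have [bx _] := interior_subset W1x.
  have xlt : \forall t \near x, w p < w t by apply: cvg_above => //; exact: (nw _ bx).1.
  by have [q [[]]] := ratpt_dense (filterI W1x xlt); exists q.
have [bx _] := interior_subset W1y.
have xlt : \forall t \near y, w t < w p by apply: cvg_below => //; exact: (nw _ bx).1.
by have [q [[]]] := ratpt_dense (filterI W1y xlt); exists q.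
Qed.

(** If [w' p < w' p'] but [w p' <= w p], then rational points near [p] and [p']
    can be pushed up and down with respect to [w], as [w] has no extremum, so
    that [w] orders them strictly the other way round, while [w'] still keeps
    them apart. *)
Lemma coded_lt C b w w' p p' : coded C b w -> coded C b w' ->
  no_extremum (ratbox b) w -> no_extremum (ratbox b) w' ->
  ratbox b p -> ratbox b p' -> w' p < w' p' -> w p < w p'.
Proof.
move=> Cw Cw' nw nw' bp bp' lt'; rewrite ltNge; apply/negP => le_w.
pose m := (w' p + w' p') / 2.
have [pm mp'] : w' p < m /\ m < w' p' by rewrite /m; split; lra.
have [[x [bx xm px]] _] := no_extremum_ratpt nw bp (cvg_below (nw' _ bp).1 pm).
have [_ [y [by_ my yp]]] := no_extremum_ratpt nw bp' (cvg_above (nw' _ bp').1 mp').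
have /(Cw' _ _ by_ bx) : C (b, y, x) by apply/(Cw _ _ by_ bx); lra.
by move: xm my => /=; lra.
Qed.

(** Hence two foliations with the same code have the same local leaves, although
    their charts need not agree. *)
Lemma coded_levels C b w w' p p' : coded C b w -> coded C b w' ->
  no_extremum (ratbox b) w -> no_extremum (ratbox b) w' ->
  ratbox b p -> ratbox b p' -> w p = w p' -> w' p = w' p'.
Proof.
move=> Cw Cw' nw nw' bp bp' E; apply/eqP; rewrite eq_le !leNgt.
apply/andP; split; apply/negP => L.
  by have := coded_lt Cw Cw' nw nw' bp' bp L; rewrite E ltxx.
by have := coded_lt Cw Cw' nw nw' bp bp' L; rewrite E ltxx.
Qed.

End codes.

(** * Modes of gluing *)

Section modes.
Variable R : realType.
Local Notation plane := (R * R)%type.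
Implicit Types (m : bool * bool) (q : plane).

(** The first component of a mode switches the shear on, the second one the
    stretching.  At y = 0 the convention 0^-1 = 0 makes this the identity. *)
Definition twist m q : plane :=
  let t := q.1 + m.1%:R * (1 - cos q.2^-1) in (t, q.2 / (1 + m.2%:R * `|t|)).

Definition untwist m q : plane :=
  let y := q.2 * (1 + m.2%:R * `|q.1|) in (q.1 - m.1%:R * (1 - cos y^-1), y).

Definition spread x q : plane := (x + q.1 * q.2, q.2).

Definition sector m x q : plane := spread x (twist m q).

Lemma stretch_gt0 (b : bool) (t : R) : 0 < 1 + b%:R * `|t|.
Proof. by rewrite ltr_pwDl// mulr_ge0. Qed.

Lemma untwistK m : cancel (untwist m) (twist m).
Proof.
move=> [t y]; rewrite /twist /untwist /= subrK; congr pair.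
by rewrite mulfK// gt_eqF// stretch_gt0.
Qed.

Lemma twistK m : cancel (twist m) (untwist m).
Proof.
move=> [t y]; rewrite /twist /untwist /= mulfVK ?gt_eqF ?stretch_gt0//.
by rewrite addrK.
Qed.

Lemma twist_id q : twist (false, false) q = q.
Proof. by rewrite /twist /= !mul0r !addr0 invr1 mulr1 -surjective_pairing. Qed.

(** The function [w], a height of the coded foliation on the box [b], may depend
    on the box; only its level sets are compared with the plaques of [c].  That
    all small boxes [b] around [e q] are considered lets one choose the same box
    for two charts. *)
Definition compatible C (e : plane -> plane) (N : set plane)
    (c : plane -> plane) :=
  forall q, N q -> 0 < q.2 -> exists2 W, nbhs (e q) W &
    forall b, ratbox b (e q) -> ratbox b `<=` W ->
    exists w, [/\ no_extremum (ratbox b) w, coded C b w &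
      \forall p \near q, ratbox b (e p) /\ ((c p).2 = (c q).2 <-> w (e p) = w (e q))].

(** The plaques of [c1] and [c2] are locally the level sets of the same coded
    function, so the height in [c2] is locally constant along the path. *)
Lemma transport C e1 N1 c1 e2 N2 c2 (g1 g2 : R -> plane) :
  compatible C e1 N1 c1 -> compatible C e2 N2 c2 ->
  continuous g1 -> continuous g2 ->
  (forall r, N1 (g1 r) /\ 0 < (g1 r).2) -> (forall r, N2 (g2 r) /\ 0 < (g2 r).2) ->
  (forall r, e1 (g1 r) = e2 (g2 r)) ->
  (forall r s, (c1 (g1 r)).2 = (c1 (g1 s)).2) ->
  forall r s, (c2 (g2 r)).2 = (c2 (g2 s)).2.
Proof.
move=> C1 C2 cg1 cg2 N1g N2g eg vg1; apply: locally_constant => r.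
have [W1 nW1 H1] := C1 _ (N1g r).1 (N1g r).2.
have [W2 nW2 H2] := C2 _ (N2g r).1 (N2g r).2.
rewrite -eg in nW2.
have [b bq bW] := ratbox_basis (filterI nW1 nW2).
have [w1 [nw1 cw1 L1]] := H1 b bq (fun x h => (bW x h).1).
have [|w2 [nw2 cw2 L2]] := H2 b _ (fun x h => (bW x h).2); first by rewrite -eg.
have {}L1 := cg1 r _ L1; have {}L2 := cg2 r _ L2.
near=> s.
have [b1 E1] : ratbox b (e1 (g1 s)) /\ ((c1 (g1 s)).2 = (c1 (g1 r)).2 <-> w1 (e1 (g1 s)) = w1 (e1 (g1 r))).
  by near: s.
have [b2 E2] : ratbox b (e2 (g2 s)) /\ ((c2 (g2 s)).2 = (c2 (g2 r)).2 <-> w2 (e2 (g2 s)) = w2 (e2 (g2 r))).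
  by near: s.
apply/E2; rewrite -!eg; apply: (coded_levels cw1 cw2 nw1 nw2) => //.
by apply/E1.
Unshelve. all: by end_near. Qed.

End modes.

(** * Zigzags *)

Section zigzag.
Variable R : realType.
Local Notation plane := (R * R)%type.

(** The parameter of the plaque is monotone along the path, hence its value at
    [g r] lies between the values at [g p] and [g q], which are both close to
    the value at [al]; the height is constant.  So [c be] would be close to
    [c al]. *)
Lemma no_zigzag N (c : plane -> plane) (al be : plane) :
  box_chart N c -> N al -> N be -> al <> be ->
  exists2 e, 0 < e & forall (g : R -> plane) p r q, continuous g ->
    (forall s, N (g s)) -> (forall s s', (c (g s)).2 = (c (g s')).2) ->
    (forall s s', p <= s <= q -> p <= s' <= q -> g s = g s' -> s = s') ->
    p < r < q -> square al e (g p) -> square al e (g q) -> square be e (g r) ->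
    False.
Proof.
move=> bc Na Nb ab.
have cab : c al <> c be by move/(box_chart_inj bc Na Nb).
have [oN cc _] := bc.
pose d := Num.max `|(c al).1 - (c be).1| `|(c al).2 - (c be).2|.
have d0 : 0 < d.
  rewrite lt_max !normr_gt0 !subr_eq0 -negb_and; apply/negP => /andP[/eqP E1 /eqP E2].
  by apply: cab; rewrite (surjective_pairing (c al)) E1 E2 -surjective_pairing.
have nbh x : N x -> exists2 e, 0 < e & forall y, square x e y -> square (c x) (d / 2) (c y).
  move=> Nx; apply/nbhs_squareP; apply: (cc _ Nx); apply: open_nbhs_nbhs; split.
    exact: square_open.
  by apply: square_center; rewrite divr_gt0.
have [e1 e10 H1] := nbh _ Na; have [e2 e20 H2] := nbh _ Nb.
exists (Num.min e1 e2); first by rewrite lt_min e10.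
move=> g p r q cg Ng vg ginj /andP[pr rq] gp gq gr.
have sub x y : square x (Num.min e1 e2) y -> square x e1 y /\ square x e2 y.
  by rewrite /square /= => -[]; rewrite !lt_min => /andP[? ?] /andP[? ?].
have [P1 P2] := H1 _ (sub _ _ gp).1; have [Q1 Q2] := H1 _ (sub _ _ gq).1.
have [S1 S2] := H2 _ (sub _ _ gr).2.
pose f s := (c (g s)).1.
have cf : continuous f.
  move=> s; apply: (@continuous_comp _ _ _ (c \o g) fst); last exact: fst_continuous.
  by apply: continuous_comp; [exact: cg|exact: cc].
have finj s s' : p <= s <= q -> p <= s' <= q -> f s = f s' -> s = s'.
  move=> hs hs' E; apply: ginj => //; apply: (box_chart_inj bc) => //.
  by rewrite (surjective_pairing (c (g s))) [X in (X, _)]E (vg s s') -surjective_pairing.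
have F := injective_monotone cf finj (lexx p) pr rq (lexx q).
have V := vg p r.
suff : d < d by rewrite ltxx.
rewrite {1}/d gt_max; move: P1 P2 Q1 Q2 S1 S2; rewrite !ltr_norml -/(f p) -/(f q) -/(f r) V.
move=> /andP[? ?] /andP[? ?] /andP[? ?] /andP[? ?] /andP[? ?] /andP[? ?].
by apply/andP; split; apply/andP; split; move: F => [/andP[? ?]|/andP[? ?]]; lra.
Qed.

(** The reciprocal of the second coordinate of [untwist], with stretching if [l]
    holds; the shear depends on the cosine of this value. *)
Definition level_fun (l : bool) (q : plane) : R := (q.2 * (1 + l%:R * `|q.1|))^-1.

Lemma level_continuous l (q : plane) : 0 < q.2 -> {for q, continuous (level_fun l)}.
Proof.
move=> q0; rewrite /prop_for /continuous_at /level_fun; apply: cvgV.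
  by rewrite mulf_neq0// gt_eqF// stretch_gt0.
apply: cvgM; first exact: cvg_snd.
apply: cvgD; first exact: cvg_cst.
by apply: cvgM; [exact: cvg_cst|apply: cvg_norm; exact: cvg_fst].
Qed.

Lemma cos_band (th : R) (j : nat) s : 0 <= th -> th <= pi ->
  pi *+ 2 *+ j - th <= s <= pi *+ 2 *+ j + th -> cos th <= cos s.
Proof.
move=> th0 thpi /andP[s1 s2].
have -> : cos s = cos `|s - pi *+ 2 *+ j|.
  by rewrite cos_norm -[in LHS](subrK (pi *+ 2 *+ j) s) (periodicn (@cosD2pi R)).
have h : `|s - pi *+ 2 *+ j| <= th by rewrite ler_norml; apply/andP; split; lra.
rewrite leNgt ltr_cos -?leNgt// in_itv /= ?th0 ?thpi// normr_ge0.
exact: le_trans thpi.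
Qed.

(** Between the levels L and M the cosine rises from [cos th] to 1 and falls
    again.  In the sheared mode the path therefore goes from near - k to near 0
    and back, with k = 1 - cos th, and stays in the domain of the chart because
    k is small. *)
Lemma shear_no_crossing C x l N c th e : box_chart N c ->
  compatible C (sector (true, l) x) N c -> 0 < e -> square (0, 0) e `<=` N ->
  0 < th -> th < pi -> 0 < 1 - cos th -> 1 - cos th < e / 2 ->
  exists2 e', 0 < e' & forall N0 c0 (g : R -> plane) a b (j : nat),
    compatible C (sector (false, false) x) N0 c0 ->
    continuous g -> (forall r, [/\ N0 (g r), `|(g r).1| < e' & 0 < (g r).2]) ->
    (forall s s', (c0 (g s)).2 = (c0 (g s')).2) ->
    (forall s s', a <= s <= b -> a <= s' <= b -> g s = g s' -> s = s') ->
    a <= b ->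
    let L := pi *+ 2 *+ j - th in let M := pi *+ 2 *+ j + th in
    0 < L -> L^-1 < e' ->
    (level_fun l (g a) <= L /\ M <= level_fun l (g b)) \/
    (M <= level_fun l (g a) /\ level_fun l (g b) <= L) -> False.
Proof.
move=> bc cC e0 eN th0 thpi k0 ke.
pose k := 1 - cos th; rewrite -/k in k0 ke.
have Na : N (- k, 0).
  by apply: eN; split; rewrite /= subr0 ?normr0// normrN gtr0_norm//; lra.
have Nb : N (0, 0) by apply: eN; exact: square_center.
have [|e1 e10 H] := no_zigzag bc Na Nb; first by case => E; lra.
exists (Num.min e1 (e / 2)); first by rewrite lt_min e10 divr_gt0.
move=> N0 c0 g a b j C0 cg Ng vg ginj ab L M L0 Le cross.
pose f r := level_fun l (g r).
have cf : continuous f.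
  move=> r; apply: (@continuous_comp _ _ _ g (level_fun l)); first exact: cg.
  by apply: level_continuous; have [] := Ng r.
have [|||p [r [q [ap qb /andP[pr rq] [fp fr fq] fpq]]]] := @crossing3 _ f a b L (pi *+ 2 *+ j) M cf ab.
- by rewrite /L; lra.
- by rewrite /M; lra.
- exact: cross.
pose g1 s := g (clamp p q s).
have pq : p <= q by exact/ltW/(lt_trans pr).
have cl s := clamp_itv s pq.
have cg1 : continuous g1.
  by move=> s; apply: (@continuous_comp _ _ _ (clamp p q) g); [exact: clamp_continuous|exact: cg].
pose g2 s := untwist (true, l) (g1 s).
pose f1 s := f (clamp p q s).
have f1L s : L <= f1 s <= M by exact: fpq.
have g2E s : g2 s = ((g1 s).1 - (1 - cos (f1 s)), (f1 s)^-1).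
  by rewrite /g2 /untwist /= mul1r /f1 /f /level_fun invrK.
have cf1 : continuous f1.
  by move=> s; apply: (@continuous_comp _ _ _ (clamp p q) f); [exact: clamp_continuous|exact: cf].
have cg2 : continuous g2.
  rewrite (_ : g2 = fun s => ((g1 s).1 - (1 - cos (f1 s)), (f1 s)^-1)); last exact/funext.
  move=> s; apply: (@pair_continuous _ _ (fun s => (g1 s).1 - (1 - cos (f1 s))) (fun s => (f1 s)^-1)).
    apply: cvgB; last first.
      apply: cvgB; first exact: cvg_cst.
      by apply: (@continuous_comp _ _ _ f1 cos); [exact: cf1|exact: continuous_cos].
    by apply: (@continuous_comp _ _ _ g1 fst); [exact: cg1|exact: fst_continuous].
  apply: cvgV; last exact: cf1.
  by rewrite gt_eqF//; have /andP[h _] := f1L s; exact: lt_le_trans h.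
have f1V s : 0 < (f1 s)^-1 /\ (f1 s)^-1 < Num.min e1 (e / 2).
  have /andP[h _] := f1L s; have f10 : 0 < f1 s by exact: lt_le_trans h.
  split; first by rewrite invr_gt0.
  by apply: le_lt_trans Le; rewrite lef_pV2// posrE.
have g1e s : `|(g1 s).1| < Num.min e1 (e / 2) by have [] := Ng (clamp p q s).
have cosf s : cos th <= cos (f1 s) by apply: cos_band (f1L s); exact: ltW.
have Ng2 s : N (g2 s).
  apply: eN; rewrite g2E; have [v0 ve] := f1V s; have := g1e s.
  move: ve; rewrite !lt_min => /andP[_ ve] /andP[_]; rewrite ltr_norml => /andP[u1 u2].
  have := cosf s; have := cos_le1 (f1 s); move=> w1 w2.
  by split; rewrite /= subr0 ltr_norml; apply/andP; split; rewrite /k in ke; lra.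
have vg2 : forall s s', (c (g2 s)).2 = (c (g2 s')).2.
  apply: (transport C0 cC cg1 cg2).
  - by move=> s; have [] := Ng (clamp p q s).
  - by move=> s; split => //; rewrite g2E; have [] := f1V s.
  - by move=> s; rewrite /sector /g2 untwistK twist_id.
  - by move=> s s'; exact: vg.
have fcos t : f t = L \/ f t = M -> cos (f t) = cos th.
  by case => ->; rewrite /L /M 1?addrC (periodicn (@cosD2pi R)) ?cosN.
have f1id t : p <= t <= q -> f1 t = f t by move=> h; rewrite /f1 clamp_id.
apply: (H g2 p r q cg2 Ng2 vg2) => //.
- move=> s s' hs hs' /(congr1 (twist (true, l))); rewrite !untwistK /g1 !clamp_id//.
  move/andP : hs => [? ?]; move/andP : hs' => [? ?].
  by apply: ginj; apply/andP; split; lra.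
- by rewrite pr.
- have := g1e p; have [v0] := f1V p; rewrite !lt_min => /andP[v1 _] /andP[v2 _].
  rewrite g2E; split; rewrite /= ?subr0 ?(gtr0_norm v0)//.
  by rewrite f1id ?lexx// fcos// -/k opprK subrK.
- have := g1e q; have [v0] := f1V q; rewrite !lt_min => /andP[v1 _] /andP[v2 _].
  rewrite g2E; split; rewrite /= ?subr0 ?(gtr0_norm v0)//.
  by rewrite f1id ?lexx ?pq// fcos// -/k opprK subrK.
- have prq : p <= r <= q by rewrite !ltW.
  have := g1e r; have [v0] := f1V r; rewrite !lt_min => /andP[v1 _] /andP[v2 _].
  rewrite g2E; split; rewrite /= ?subr0 ?(gtr0_norm v0)//.
  rewrite f1id// fr -[pi *+ 2 *+ j]add0r (periodicn (@cosD2pi R)) cos0.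
  by rewrite subrr subr0.
Qed.

End zigzag.

(** * No foliation extends in all three modes *)

Section three_modes.
Variable R : realType.
Local Notation plane := (R * R)%type.

Definition extends C (x : R) (m : bool * bool) :=
  exists N c, [/\ box_chart N c, N (0, 0) & compatible C (sector m x) N c].

Lemma small_angle (e : R) : 0 < e ->
  exists th : R, [/\ 0 < th, th < pi, 0 < 1 - cos th & 1 - cos th < e].
Proof.
move=> e0; have c0 : 1 - e < cos (0 : R) by rewrite cos0; lra.
have /nbhs_ballP[d /= d0 dcos] := cvg_above (@continuous_cos R 0) c0.
have pi2 := @pi_ge2 R.
pose th := Num.min (d / 2) 1.
have th0 : 0 < th by rewrite lt_min ltr01 divr_gt0.
have th1 : th <= 1 by rewrite ge_min lexx orbT.
have thd : th <= d / 2 by rewrite ge_min lexx.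
have thc : 1 - e < cos th.
  by apply: dcos; rewrite -ball_normE /= sub0r normrN gtr0_norm//; lra.
have th_lt : cos th < 1.
  by rewrite -cos0 ltr_cos// in_itv /= ?lexx ?pi_ge0//; apply/andP; split; lra.
by exists th; split; lra.
Qed.

(** The plaque is cut at its first exit from the rectangle, so that it stays
    inside and ends on the boundary. *)
Lemma plaque_leaves_rectangle N c (dl y0 y1 y2 : R) : box_chart N c ->
  0 < dl -> y1 <= y0 -> y0 <= y2 ->
  (forall q, `|q.1| <= dl -> y1 <= q.2 <= y2 -> N q) ->
  exists (g : R -> plane) a r, [/\ continuous g /\ a <= r,
    forall s, [/\ N (g s), `|(g s).1| <= dl & y1 <= (g s).2 <= y2],
    forall s s', (c (g s)).2 = (c (g s')).2,
    forall s s', a <= s <= r -> a <= s' <= r -> g s = g s' -> s = s' &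
    g a = (0, y0) /\ [\/ `|(g r).1| = dl, (g r).2 = y1 | (g r).2 = y2]].
Proof.
move=> bc dl0 y10 y02 TN.
pose T : set plane := `[- dl, dl]%classic `*` `[y1, y2]%classic.
have TE q : T q <-> `|q.1| <= dl /\ y1 <= q.2 <= y2.
  by rewrite /T /= !in_itv /= ler_norml.
have cT : compact T by apply: compact_setX; exact: segment_compact.
have {}TN : T `<=` N by move=> q /TE[]; exact: TN.
have T0 : T (0, y0) by apply/TE; rewrite /= normr0 y10 y02 ltW.
have [gam [a [b [cgam [ab Ngam] vgam ugam [gama gamb]]]]] := plaque_exit bc cT TN T0.
have cg1 : continuous (fun r => (gam r).1).
  by move=> r; apply: (@continuous_comp _ _ _ gam fst); [exact: cgam|exact: fst_continuous].
have cg2 : continuous (fun r => (gam r).2).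
  by move=> r; apply: (@continuous_comp _ _ _ gam snd); [exact: cgam|exact: snd_continuous].
pose f r := Num.max (`|(gam r).1| - dl) (Num.max (y1 - (gam r).2) ((gam r).2 - y2)).
have cf : continuous f.
  move=> r; apply: (@continuous_max R R (fun r => `|(gam r).1| - dl) _ r).
    by apply: cvgB; [apply: cvg_norm; exact: cg1|exact: cvg_cst].
  apply: (@continuous_max R R (fun r => y1 - (gam r).2) (fun r => (gam r).2 - y2) r).
    by apply: cvgB; [exact: cvg_cst|exact: cg2].
  by apply: cvgB; [exact: cg2|exact: cvg_cst].
have Tf r : f r <= 0 <-> T (gam r).
  rewrite TE /f !ge_max !subr_le0; split; first by move=> /and3P[-> -> ->].
  by move=> [-> /andP[-> ->]].
have fa : f a <= 0 by apply/Tf; rewrite gama.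
have fb : 0 <= f b by rewrite leNgt; apply/negP => /ltW/Tf.
have [r [/andP[ar rb] fr0 fle]] := first_crossing cf ab fa fb.
have cl s := clamp_itv s ar.
exists (fun s => gam (clamp a r s)), a, r; split.
- split=> // s; apply: (@continuous_comp _ _ _ (clamp a r) gam); last exact: cgam.
  exact: clamp_continuous.
- by move=> s; have /TE[] : T (gam (clamp a r s)) by apply/Tf/fle.
- by move=> s s'; rewrite !vgam.
- move=> s s' hs hs'; rewrite !clamp_id// => E.
  have inab t : a <= t <= r -> a <= t <= b by move=> /andP[-> /le_trans->].
  by rewrite -(ugam s) ?inab// E ugam ?inab.
rewrite !clamp_id ?lexx ?ar//; split=> //.
move: fr0; rewrite /f /Num.max; case: ifP => _; last first.
  by move/eqP; rewrite subr_eq0 => /eqP; constructor 1.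
case: ifP => _ /eqP; rewrite subr_eq0 => /eqP; first by constructor 3.
by move=> E; constructor 2.
Qed.

(** For large s the starting point (0, 1 / s) of the leaf lies in the rectangle
    |t| <= d, |1 / y - s| <= 2 pi; a vertical exit is a crossing for the plain
    level function, a lateral one for the stretched level function. *)
Lemma leaf_crosses N c (e d : R) : box_chart N c -> 0 < d -> d < e ->
  square (0, 0) e `<=` N ->
  exists l (g : R -> plane) a r j, [/\ continuous g /\ a <= r,
    forall s, [/\ N (g s), `|(g s).1| <= d & 0 < (g s).2],
    forall s s', (c (g s)).2 = (c (g s')).2,
    forall s s', a <= s <= r -> a <= s' <= r -> g s = g s' -> s = s' &
    d^-1 < pi *+ 2 *+ j - pi /\
    ((level_fun l (g a) <= pi *+ 2 *+ j - pi /\ pi *+ 2 *+ j + pi <= level_fun l (g r)) \/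
     (pi *+ 2 *+ j + pi <= level_fun l (g a) /\ level_fun l (g r) <= pi *+ 2 *+ j - pi))].
Proof.
move=> bc d0 de eN; have pi2 := @pi_ge2 R.
have [m mB] : exists m : nat, (pi *+ 2 + pi *+ 2 + 1) / d < m%:R :> R.
  by eexists; apply: archi_boundP; rewrite divr_ge0// ?ltW//; lra.
pose P : R := pi *+ 2; rewrite -/P in mB *.
have Pe : P = pi + pi by rewrite /P mulr2n.
pose A := P *+ m + pi; pose s0 := A + P; pose B := s0 + P.
have Am : m%:R <= A.
  rewrite /A -(mulr_natr P m) ler_wpDr ?pi_ge0// -[leLHS]mul1r ler_wpM2r//; lra.
(* Both 1 / d < A and 2 P < A * d hold for large m; by the latter, stretching by
   1 + d outweighs the difference 2 P of the levels in the rectangle. *)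
have Adl : P + P + 1 < A * d by rewrite -ltr_pdivrMr//; exact: lt_le_trans Am.
have A0 : 0 < A by apply: lt_le_trans Am; apply: le_lt_trans mB; rewrite divr_ge0// ?ltW//; lra.
have s00 : 0 < s0 by rewrite /s0; lra.
have B0 : 0 < B by rewrite /B; lra.
have Vdl : d^-1 < A by rewrite -[ltLHS]mul1r ltr_pdivrMr//; lra.
have Ad : A^-1 < d by rewrite invf_plt ?posrE.
have BS : B^-1 <= s0^-1 by rewrite lef_pV2 ?posrE// /B; lra.
have SA : s0^-1 <= A^-1 by rewrite lef_pV2 ?posrE// /s0; lra.
have VB0 : 0 < B^-1 by rewrite invr_gt0.
have Pm1 : P *+ m.+1 - pi = A by rewrite mulrS /A Pe; lra.
have Pm1' : P *+ m.+1 + pi = s0 by rewrite mulrS /s0 /A Pe; lra.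
have Pm2 : P *+ m.+2 - pi = s0 by rewrite 2!mulrS /s0 /A Pe; lra.
have Pm2' : P *+ m.+2 + pi = B by rewrite 2!mulrS /B /s0 /A Pe; lra.
have As0 : A <= s0 by rewrite /s0; lra.
have Bd : B <= (1 + d) * A by rewrite mulrDl mul1r (mulrC d) /B /s0; lra.
have TN q : `|q.1| <= d -> B^-1 <= q.2 <= A^-1 -> N q.
  move=> q1 /andP[q2 q3]; apply: eN; rewrite /square /= !subr0.
  by rewrite (le_lt_trans q1 de) gtr0_norm ?(lt_le_trans VB0)// (le_lt_trans q3)// (lt_trans Ad).
have [g [a [r [[cg ar] gT vg ginj [ga gr]]]]] := plaque_leaves_rectangle bc d0 BS SA TN.
have gP s : [/\ N (g s), `|(g s).1| <= d & 0 < (g s).2].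
  by have [? ? /andP[h _]] := gT s; split => //; exact: lt_le_trans h.
have lev0 l : level_fun l (g a) = s0.
  by rewrite ga /level_fun /= normr0 mulr0 addr0 mulr1 invrK.
have plain q : level_fun false q = q.2^-1 :> R by rewrite /level_fun mul0r addr0 mulr1.
case: gr => gr.
- exists true, g, a, r, m.+1; split => //; rewrite Pm1 Pm1' lev0; split => //; right.
  split => //; have [_ _ /andP[h2 _]] := gT r; have [_ _ g20] := gP r.
  have d1 : 0 < 1 + d by rewrite addr_gt0.
  rewrite /level_fun gr mul1r invf_ple ?posrE ?mulr_gt0//.
  apply: (@le_trans _ _ (B^-1 * (1 + d))); last by rewrite ler_pM2r.
  by rewrite ler_pdivlMl// ler_pdivrMr.
- exists false, g, a, r, m.+2; split => //; rewrite Pm2 Pm2' lev0 plain gr invrK.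
  by split; [exact: lt_le_trans Vdl As0|left].
- by exists false, g, a, r, m.+1; split => //; rewrite Pm1 Pm1' lev0 plain gr invrK; split => //; right.
Qed.

Theorem not_all_extend C x : extends C x (false, false) ->
  extends C x (true, false) -> extends C x (true, true) -> False.
Proof.
move=> [N0 [c0 [bc0 N00 cC0]]] [N1 [c1 [bc1 N10 cC1]]] [N2 [c2 [bc2 N20 cC2]]].
have nbN (N : set plane) c : box_chart N c -> N (0, 0) -> nbhs (0, 0) N.
  by move=> [oN _ _] NO; apply: open_nbhs_nbhs.
have /nbhs_squareP[e e0 eN] : nbhs (0 : R, 0 : R) (N0 `&` N1 `&` N2).
  by do 2?[apply: filterI]; [exact: nbN bc0 N00|exact: nbN bc1 N10|exact: nbN bc2 N20].
have [|th [th0 thpi k0 ke]] := @small_angle (e / 2); first by rewrite divr_gt0.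
have [e1 e10 H1] := shear_no_crossing bc1 cC1 e0 (fun x h => (eN x h).1.2) th0 thpi k0 ke.
have [e2 e20 H2] := shear_no_crossing bc2 cC2 e0 (fun x h => (eN x h).2) th0 thpi k0 ke.
have [d [d0 de de12]] : exists d : R, [/\ 0 < d, d < e & forall l : bool, d < if l then e2 else e1].
  have m0 : 0 < Num.min e (Num.min e1 e2) by rewrite !lt_min e0 e10.
  exists (Num.min e (Num.min e1 e2) / 2); split; first by rewrite divr_gt0.
    by apply: (@lt_le_trans _ _ (Num.min e (Num.min e1 e2))); [lra|rewrite ge_min lexx].
  move=> l; apply: (@lt_le_trans _ _ (Num.min e (Num.min e1 e2))); first by lra.
  by case: l; rewrite !ge_min lexx !orbT.
have [l [g [a [r [j [[cg ar] gP vg ginj [dj cross]]]]]]] :=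
  leaf_crosses bc0 d0 de (fun x h => (eN x h).1.1).
have dV : 0 < d^-1 by rewrite invr_gt0.
have L0 : 0 < pi *+ 2 *+ j - th by lra.
have L1 : (pi *+ 2 *+ j - th)^-1 < d.
  by rewrite invf_plt ?posrE//; lra.
have gP' s : [/\ N0 (g s), `|(g s).1| < (if l then e2 else e1) & 0 < (g s).2].
  by have [? h ?] := gP s; split => //; exact: le_lt_trans h (de12 l).
have cross' : (level_fun l (g a) <= pi *+ 2 *+ j - th /\ pi *+ 2 *+ j + th <= level_fun l (g r)) \/
     (pi *+ 2 *+ j + th <= level_fun l (g a) /\ level_fun l (g r) <= pi *+ 2 *+ j - th).
  by case: cross => -[h1 h2]; [left|right]; split; lra.
have L2 := lt_trans L1 (de12 l).
case: l gP' cross' L2 {cross} => gP' cross' L2.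
  exact: (H2 N0 c0 g a r j cC0 cg gP' vg ginj ar L0 L2 cross').
exact: (H1 N0 c0 g a r j cC0 cg gP' vg ginj ar L0 L2 cross').
Qed.

End three_modes.

(** * Continuity of the modes *)

Section mode_continuity.
Variable R : realType.
Local Notation plane := (R * R)%type.
Implicit Types (m : bool * bool) (q p : plane) (x : R).

Definition unspread x p : plane := ((p.1 - x) / p.2, p.2).

Definition unsector m x p : plane := untwist m (unspread x p).

Lemma sector_eq0 m x q : ((sector m x q).2 == 0) = (q.2 == 0).
Proof. by rewrite /sector /= mulf_eq0 invr_eq0 (gt_eqF (stretch_gt0 _ _)) orbF. Qed.

Lemma sector_gt0 m x q : (0 < (sector m x q).2) = (0 < q.2).
Proof. by rewrite /sector /= pmulr_lgt0// invr_gt0 stretch_gt0. Qed.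

Lemma unsector_eq0 m x p : ((unsector m x p).2 == 0) = (p.2 == 0).
Proof. by rewrite /unsector /= mulf_eq0 (gt_eqF (stretch_gt0 _ _)) orbF. Qed.

Lemma sectorK m x q : q.2 != 0 -> unsector m x (sector m x q) = q.
Proof.
rewrite -(sector_eq0 m x); rewrite /unsector /unspread /sector /spread /= => q0.
by rewrite addrC addKr mulfK// -[RHS](twistK m).
Qed.

Lemma unsectorK m x p : p.2 != 0 -> sector m x (unsector m x p) = p.
Proof.
move=> p0; rewrite /unsector /sector untwistK /spread /unspread /=.
by rewrite mulfVK// addrC subrK -surjective_pairing.
Qed.

Lemma sector_axis m x q : q.2 = 0 -> sector m x q = (x, 0).
Proof. by rewrite /sector /spread /= => ->; rewrite mul0r mulr0 addr0. Qed.

Lemma stretch_continuous (b : bool) (t : R) : {for t, continuous (fun t : R => 1 + b%:R * `|t| : R)}.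
Proof.
apply: cvgD; first exact: cvg_cst.
by apply: cvgM; [exact: cvg_cst|exact: norm_continuous].
Qed.

Lemma cosV_continuous (y : R) : y != 0 -> {for y, continuous (fun y : R => 1 - cos y^-1 : R)}.
Proof.
move=> y0; apply: cvgB; first exact: cvg_cst.
apply: (@continuous_comp R R R (fun y : R => y^-1) (@cos R)); first exact: inv_continuous.
exact: continuous_cos.
Qed.

Lemma unsector_continuous m x p : p.2 != 0 -> {for p, continuous (unsector m x)}.
Proof.
move=> p0; apply: (@continuous_comp _ _ _ (unspread x) (untwist m)).
  apply: (@pair_continuous R _ (fun p => (p.1 - x) / p.2) snd); last exact: snd_continuous.
  apply: cvgM; first by apply: cvgB; [exact: cvg_fst|exact: cvg_cst].
  by apply: cvgV => //; exact: cvg_snd.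
move: (unspread x p) (p0 : (unspread x p).2 != 0) => {p0}p p0.
have cy : {for p, continuous (fun q : plane => q.2 * (1 + m.2%:R * `|q.1|))}.
  apply: cvgM; first exact: cvg_snd.
  apply: (@continuous_comp _ _ _ fst (fun t : R => 1 + m.2%:R * `|t| : R)); first exact: fst_continuous.
  exact: stretch_continuous.
apply: (@pair_continuous R _ (fun q => q.1 - m.1%:R * (1 - cos (q.2 * (1 + m.2%:R * `|q.1|))^-1))
  (fun q => q.2 * (1 + m.2%:R * `|q.1|))); last exact: cy.
apply: cvgB; first exact: cvg_fst.
apply: cvgM; first exact: cvg_cst.
apply: (@continuous_comp _ _ _ (fun q : plane => q.2 * (1 + m.2%:R * `|q.1|)) (fun y : R => 1 - cos y^-1 : R)).
  exact: cy.
by apply: cosV_continuous; rewrite mulf_neq0// gt_eqF// stretch_gt0.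
Qed.

Lemma sector_continuous_off m x q : q.2 != 0 -> {for q, continuous (sector m x)}.
Proof.
move=> q0; apply: (@continuous_comp _ _ _ (twist m) (spread x)).
  have ct : {for q, continuous (fun q : plane => q.1 + m.1%:R * (1 - cos q.2^-1))}.
    apply: cvgD; first exact: cvg_fst.
    apply: cvgM; first exact: cvg_cst.
    apply: (@continuous_comp _ _ _ snd (fun y : R => 1 - cos y^-1 : R)); first exact: snd_continuous.
    exact: cosV_continuous.
  apply: (@pair_continuous R _ (fun q => q.1 + m.1%:R * (1 - cos q.2^-1))
     (fun q => q.2 / (1 + m.2%:R * `|q.1 + m.1%:R * (1 - cos q.2^-1)|))); first exact: ct.
  apply: cvgM; first exact: cvg_snd.
  apply: cvgV; first by rewrite gt_eqF// stretch_gt0.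
  apply: (@continuous_comp _ _ _ (fun q : plane => q.1 + m.1%:R * (1 - cos q.2^-1)) (fun t : R => 1 + m.2%:R * `|t| : R)).
    exact: ct.
  exact: stretch_continuous.
apply: (@pair_continuous R _ (fun q => x + q.1 * q.2) snd); last exact: snd_continuous.
apply: cvgD; first exact: cvg_cst.
by apply: cvgM; [exact: cvg_fst|exact: cvg_snd].
Qed.

(** Near the axis the shear stays bounded, so t * y tends to 0 with y.  Thus the
    plane coordinates are continuous across each added line, in every mode. *)
Lemma sector_continuous m x : continuous (sector m x).
Proof.
move=> q; have [q0|q0] := eqVneq q.2 0; last exact: sector_continuous_off.
move=> W; rewrite sector_axis// => /nbhs_squareP[e e0 eW].
pose b := `|q.1| + 3.
have b0 : 0 < b by rewrite ltr_wpDl.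
apply/nbhs_squareP; exists (Num.min 1 (e / b)); first by rewrite lt_min ltr01 divr_gt0.
move=> p [] /=; rewrite !lt_min => /andP[p1 _] /andP[_]; rewrite q0 subr0 => p2.
apply: eW.
set t := (twist m p).1; set y := (twist m p).2.
have tb : `|t| <= b.
  have h1 : `|p.1| <= `|q.1| + 1.
    by rewrite -(subrK q.1 p.1) addrC (le_trans (ler_normD _ _))//; lra.
  have h2 : `|m.1%:R * (1 - cos p.2^-1)| <= 2 :> R.
    rewrite ger0_norm; last by rewrite mulr_ge0// subr_ge0 cos_le1.
    have := cos_geN1 p.2^-1; have := cos_le1 p.2^-1; case: (m.1) => /=; lra.
  by rewrite /t /= (le_trans (ler_normD _ _))// /b; lra.
have ye : `|y| <= `|p.2|.
  rewrite /y /= normrM normfV (gtr0_norm (stretch_gt0 _ _)).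
  by rewrite ler_pdivrMr ?stretch_gt0// ler_peMr// lerDl mulr_ge0.
have p2b : `|p.2| * b < e by rewrite -ltr_pdivlMr.
have b1 : 1 <= b by rewrite /b; have := normr_ge0 q.1; lra.
have -> : sector m x p = (x + t * y, y) by [].
split => /=.
  rewrite addrAC subrr add0r normrM mulrC; apply: le_lt_trans p2b.
  by apply: ler_pM.
rewrite subr0; apply: le_lt_trans p2b; apply: (le_trans ye).
by rewrite ler_peMr.
Qed.

End mode_continuity.

(** * The surface and its patches *)

Lemma snd_neq0_near (R : realType) (q : R * R) : q.2 != 0 ->
  \forall r \near q, r.2 != 0.
Proof.
move=> q0; exact: (@snd_continuous R q _ (open_nbhs_nbhs (conj (@open_neq R 0) q0))).
Qed.

Section prufer_def.
Variable R : realType.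

(** The points (a, 0, y) with y <> 0 are the points (a, y) of the plane; the
    points (x, t, 0) form the line added over (x, 0). *)
Definition prufer_point : pred (R * R * R) := fun p => (p.2 == 0) || (p.1.2 == 0).

Definition prufer (m : R -> bool * bool) : Type := {p : R * R * R | prufer_point p}.

HB.instance Definition _ m := Choice.on (prufer m).

End prufer_def.

Section prufer_charts.
Variables (R : realType) (m : R -> bool * bool).
Local Notation plane := (R * R)%type.
Local Notation S := (prufer m).
Implicit Types (q : plane) (p : S) (x t : R).

Lemma prufer_axisP x t : prufer_point (x, t, 0).
Proof. by rewrite /prufer_point /= eqxx. Qed.

Lemma prufer_bulkP (q : plane) : prufer_point (q.1, 0, q.2).
Proof. by rewrite /prufer_point /= eqxx orbT. Qed.

Definition axis x t : S := exist _ (x, t, 0) (prufer_axisP x t).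
Definition bulk q : S := exist _ (q.1, 0, q.2) (prufer_bulkP q).

HB.instance Definition _ := isPointed.Build (prufer m) (bulk (0, 1)).

(** The projection to the plane, which collapses each added line. *)
Definition foot p : plane := ((sval p).1.1, (sval p).2).

Definition patch x q : S := if q.2 == 0 then axis x q.1 else bulk (sector (m x) x q).

(** The inverse of [patch x] on its image, which consists of the half-planes and
    of the line over (x, 0). *)
Definition unpatch x p : plane :=
  if (foot p).2 == 0 then ((sval p).1.2, 0) else unsector (m x) x (foot p).

Lemma foot_patch x q : foot (patch x q) = sector (m x) x q.
Proof.
by rewrite /patch; case: eqP => [q0|_]; [rewrite sector_axis|rewrite [RHS]surjective_pairing].
Qed.

Lemma foot_bulk q : foot (bulk q) = q.
Proof. by rewrite [RHS]surjective_pairing. Qed.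

Lemma patchK x : cancel (patch x) (unpatch x).
Proof.
move=> q; rewrite /unpatch foot_patch sector_eq0 /patch; case: eqP => [q0|/eqP q0].
  by rewrite [RHS]surjective_pairing q0.
by rewrite sectorK.
Qed.

Lemma unpatchK x p : (foot p).2 != 0 \/ (foot p).1 = x -> patch x (unpatch x p) = p.
Proof.
rewrite /unpatch; case: (eqVneq (foot p).2 0) => [p0 [//|px]|p0 _].
  rewrite /patch eqxx; apply: val_inj => /=; rewrite -px; move: p0.
  by case: (p) => -[[a t] y] /= _ ->.
rewrite /patch unsector_eq0 (negbTE p0) unsectorK//; apply: val_inj => /=.
by move: p0; case: (p) => -[[a t] y]; rewrite /prufer_point /= => /orP[->//|/eqP ->].
Qed.

Lemma bulk_foot p : (foot p).2 != 0 -> bulk (foot p) = p.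
Proof.
move=> p0; apply: val_inj; move: p0; case: (p) => -[[a t] y].
by rewrite /prufer_point /= => /orP[->//|/eqP->].
Qed.

(** The final topology of the patches; by [patch_open] they are open embeddings. *)
Definition prufer_open (O : set S) := forall x, open (patch x @^-1` O).

Lemma prufer_openT : prufer_open setT.
Proof. by move=> x; rewrite preimage_setT; exact: openT. Qed.

Lemma prufer_openI : setI_closed prufer_open.
Proof. by move=> A B oA oB x; rewrite preimage_setI; exact: openI. Qed.

Lemma prufer_open_bigU (I : Type) (f : I -> set S) :
  (forall i, prufer_open (f i)) -> prufer_open (\bigcup_i f i).
Proof.
by move=> of_ x; rewrite preimage_bigcup; apply: bigcup_open => i _; exact: of_.
Qed.

HB.instance Definition _ := isOpenTopological.Build (prufer m)
  prufer_openT prufer_openI prufer_open_bigU.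

Lemma patch_continuous x : continuous (patch x).
Proof. by apply/continuousP => O; apply. Qed.

Lemma transition_near x x' q : q.2 != 0 ->
  \forall r \near q, patch x r = patch x' (unsector (m x') x' (sector (m x) x r)).
Proof.
move=> /snd_neq0_near; apply: filterS => r r0; rewrite /patch unsector_eq0 sector_eq0 (negbTE r0).
by rewrite unsectorK// sector_eq0.
Qed.

(** On the overlap of two different patches the change of coordinates is
    continuous, as it takes place in the half-planes only. *)
Lemma patch_open x (W : set plane) : open W -> open (patch x @` W).
Proof.
move=> oW; suff : prufer_open (patch x @` W) by [].
move=> x'; rewrite openE => q [w Ww wq].
have [xx'|xx'] := eqVneq x x'.
  subst x'.
  have qw : w = q by rewrite -(patchK x w) wq patchK.
  rewrite qw in Ww; apply: filterS (open_nbhs_nbhs (conj oW Ww)) => r Wr.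
  by exists r.
have q0 : q.2 != 0.
  apply/negP => /eqP q0; move/eqP : xx'; apply.
  have w0 : w.2 = 0.
    by apply/eqP; rewrite -(sector_eq0 (m x) x) -foot_patch wq foot_patch sector_eq0 q0.
  have : (foot (patch x w)).1 = (foot (patch x' q)).1 by rewrite wq.
  by rewrite !foot_patch !sector_axis.
have wE : unsector (m x) x (sector (m x') x' q) = w.
  rewrite -(patchK x w) wq /unpatch foot_patch sector_eq0 (negbTE q0)//.
have ct : {for q, continuous (unsector (m x) x \o sector (m x') x')}.
  apply: continuous_comp; first exact: sector_continuous.
  by apply: unsector_continuous; rewrite sector_eq0.
have := ct W; rewrite /= wE => /(_ (open_nbhs_nbhs (conj oW Ww))) nW.
near=> r; exists (unsector (m x) x (sector (m x') x' r)); first by near: r.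
by apply/esym; near: r; exact: transition_near.
Unshelve. all: by end_near. Qed.

Lemma nbhs_patch x q (W : set S) : nbhs q (patch x @^-1` W) <-> nbhs (patch x q) W.
Proof.
split=> [h|]; last exact: patch_continuous.
apply: (@filterS _ _ _ (patch x @` (patch x @^-1` W)°)).
  by move=> _ [r /interior_subset Wr <-].
apply: open_nbhs_nbhs; split; first by apply: patch_open; exact: open_interior.
by exists q.
Qed.

Lemma continuous_patch (T : topologicalType) (f : S -> T) x q :
  {for q, continuous (f \o patch x)} -> {for patch x q, continuous f}.
Proof. by move=> cf W fW; apply/nbhs_patch; exact: cf. Qed.

Lemma patch_foot p : patch (foot p).1 (unpatch (foot p).1 p) = p.
Proof. by apply: unpatchK; right. Qed.

Lemma unpatch_continuous x q : {for patch x q, continuous (unpatch x)}.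
Proof.
apply: continuous_patch => W /=; rewrite /= patchK => h.
by rewrite /nbhs /=; apply: filterS h => r Wr; rewrite /= patchK.
Qed.

Lemma foot_continuous : continuous foot.
Proof.
move=> p; rewrite -(patch_foot p); apply: continuous_patch.
rewrite (_ : _ \o _ = sector (m (foot p).1) (foot p).1); first exact: sector_continuous.
by apply/funext => q; exact: foot_patch.
Qed.

Lemma bulk_continuous q : q.2 != 0 -> {for q, continuous bulk}.
Proof.
move=> q0; have : {for q, continuous (patch 0 \o unsector (m 0) 0)}.
  by apply: continuous_comp; [exact: unsector_continuous|exact: patch_continuous].
have E r : r.2 != 0 -> patch 0 (unsector (m 0) 0 r) = bulk r.
  by move=> r0; rewrite /patch unsector_eq0 (negbTE r0) unsectorK.
move=> ct; rewrite /prop_for /continuous_at -(E q q0) => W /ct /= h.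
have nz := snd_neq0_near q0.
suff : \forall r \near q, W (bulk r) by [].
by near=> r; rewrite -E; near: r.
Unshelve. all: by end_near. Qed.

Lemma nbhs_bulk q (W : set S) : q.2 != 0 -> nbhs q (bulk @^-1` W) <-> nbhs (bulk q) W.
Proof.
move=> q0; split; last exact: bulk_continuous.
have E : bulk q = patch 0 (unsector (m 0) 0 q).
  by rewrite /patch unsector_eq0 (negbTE q0) unsectorK.
have -> : nbhs q = nbhs (foot (bulk q)) by rewrite foot_bulk.
move=> /foot_continuous h.
have nz : \forall p \near bulk q, (foot p).2 != 0.
  have h0 : nbhs (foot (bulk q)) [set r | r.2 != 0].
    by rewrite foot_bulk; exact: snd_neq0_near.
  exact: foot_continuous h0.
near=> p.
rewrite -(bulk_foot (p := p)); last by near: p.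
by near: p.
Unshelve. all: by end_near. Qed.

End prufer_charts.

(** * Topology of the surface *)

Lemma matrix_continuous (T U : topologicalType) (k l : nat) (f : T -> 'M[U]_(k, l)) (x : T) :
  (forall i j, {for x, continuous (fun y => f y i j)}) -> {for x, continuous f}.
Proof.
move=> cf W [P nP PW].
have : \forall y \near x, forall i j, P i j (f y i j).
  by apply: filter_forall => i; apply: filter_forall => j; exact: cf.
by apply: filterS => y h; exact: PW.
Qed.

Section prufer_topology.
Variables (R : realType) (m : R -> bool * bool).
Local Notation plane := (R * R)%type.
Local Notation S := (prufer m).

Definition row2 (q : plane) : 'rV[R]_2 := \row_(i < 2) (if i == ord0 then q.1 else q.2).

Definition unrow2 (v : 'rV[R]_2) : plane := (v ord0 ord0, v ord0 ord_max).

Lemma row2K : cancel row2 unrow2.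
Proof. by move=> q; rewrite /row2 /unrow2 !mxE /= -surjective_pairing. Qed.

Lemma unrow2K : cancel unrow2 row2.
Proof.
move=> v; apply/rowP => i; rewrite mxE /unrow2 /=.
by case: (unliftP ord0 i) => [j ->|->//]; rewrite (ord1 j) /=; congr (v _ _); exact: val_inj.
Qed.

Lemma row2_continuous : continuous row2.
Proof.
move=> q; apply: matrix_continuous => i j.
rewrite (_ : (fun y => _) = fun y : plane => if j == ord0 then y.1 else y.2).
  by case: (j == ord0); [exact: fst_continuous|exact: snd_continuous].
by apply/funext => y; rewrite mxE.
Qed.

Lemma unrow2_continuous : continuous unrow2.
Proof. by move=> v; apply: pair_continuous; exact: coord_continuous. Qed.

Lemma foot_axis x t : foot (axis m x t) = (x, 0).
Proof. by []. Qed.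

Lemma patch_axis x t : patch m x (t, 0) = axis m x t.
Proof. by rewrite /patch eqxx. Qed.

Lemma open_range_patch x : open (range (patch m x)).
Proof. exact/patch_open/openT. Qed.

Lemma axis_in_range x x' t : range (patch m x) (axis m x' t) -> x' = x.
Proof.
move=> [q _ E]; have := foot_patch m x q; rewrite E foot_axis => F.
have q0 : q.2 = 0 by apply/eqP; rewrite -(sector_eq0 (m x) x) -F.
by move: F; rewrite sector_axis// => -[].
Qed.

Lemma cluster_continuous (T U : topologicalType) (f : T -> U) p q :
  hausdorff_space U -> {for p, continuous f} -> {for q, continuous f} ->
  cluster (nbhs p) q -> f p = f q.
Proof.
move=> hU fp fq pq; apply: hU => A B nA nB.
by have [r [Ar Br]] := pq _ _ (fp _ nA) (fq _ nB); exists (f r).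
Qed.

Lemma plane_hausdorff : hausdorff_space plane.
Proof. exact: norm_hausdorff. Qed.

(** Points that cannot be separated have the same projection to the plane, hence
    lie in a common patch, and there the coordinates separate them. *)
Lemma prufer_hausdorff : hausdorff_space S.
Proof.
move=> p q pq.
have E := cluster_continuous plane_hausdorff (@foot_continuous _ m p)
  (@foot_continuous _ m q) pq.
have pE := patch_foot p; have qE := patch_foot q; rewrite -E in qE.
rewrite -pE -qE; congr (patch m _ _).
apply: (cluster_continuous plane_hausdorff _ _ pq).
  by have := @unpatch_continuous R m (foot p).1 (unpatch (foot p).1 p); rewrite pE.
by have := @unpatch_continuous R m (foot p).1 (unpatch (foot p).1 q); rewrite qE.
Qed.

Lemma prufer_locally_euclidean : locally_euclidean R 2 S.
Proof.
move=> p; pose x := (foot p).1.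
exists (range (patch m x)), setT; split.
- exact: open_range_patch.
- by exists (unpatch x p) => //; exact: patch_foot.
- exact: openT.
exists (row2 \o unpatch x), (patch m x \o unrow2); split.
- by move=> _ [q _ <-] /=; rewrite row2K patchK.
- by move=> v _ /=; split; [exists (unrow2 v)|rewrite patchK unrow2K].
- apply: continuous_in_subspaceT => _ /set_mem [q _ <-].
  by apply: continuous_comp; [exact: unpatch_continuous|exact: row2_continuous].
- apply: continuous_subspaceT => v.
  by apply: continuous_comp; [exact: unrow2_continuous|exact: patch_continuous].
Qed.

Lemma prufer_connected : connected [set: S].
Proof.
(* The surface is the union of images of straight lines in the patches, all of
   them passing through the point b of the upper half-plane. *)
pose b : S := bulk m (0, 1).
pose ray (i : R * plane) (s : R) : S :=
  patch m i.1 ((unpatch i.1 b).1 + s * (i.2.1 - (unpatch i.1 b).1),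
               (unpatch i.1 b).2 + s * (i.2.2 - (unpatch i.1 b).2)).
have -> : [set: S] = \bigcup_(i in [set: R * plane]) range (ray i).
  apply/seteqP; split => // p _; exists ((foot p).1, unpatch (foot p).1 p) => //.
  exists 1 => //; rewrite /ray /= !mul1r ![_ + (_ - _)]addrC !subrK.
  by rewrite -surjective_pairing patch_foot.
apply: bigcup_connected.
  exists b => i _; exists 0 => //; rewrite /ray !mul0r !addr0 -surjective_pairing.
  by apply: unpatchK; left; rewrite foot_bulk oner_eq0.
move=> i _; apply: connected_continuous_connected; first exact/connected_intervalP.
apply: continuous_subspaceT => s.
apply: (@continuous_comp R plane S (fun s => ((unpatch i.1 b).1 + s * (i.2.1 - (unpatch i.1 b).1),
  (unpatch i.1 b).2 + s * (i.2.2 - (unpatch i.1 b).2))) (patch m i.1)); last exact: patch_continuous.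
have lin (a c : R) : {for s, continuous (fun s : R => a + s * c)}.
  apply: cvgD; first exact: cvg_cst.
  by apply: cvgM; [exact: cvg_id|exact: cvg_cst].
by apply: pair_continuous; exact: lin.
Qed.

Lemma bulk_rational_dense (p : S) (W : set S) : nbhs p W -> exists q : rat * rat, W (bulk m (ratpt R q)).
Proof.
move=> /nbhs_interior nW.
have [q Wq q0] : exists2 q, W° (bulk m q) & q.2 != 0.
  move: nW; rewrite -(patch_foot p) => /nbhs_patch /nbhs_squareP[e e0 eW].
  set q := unpatch _ _ in eW; set x := (foot p).1 in eW *.
  have [y [y0 ye]] : exists y : R, y != 0 /\ `|y - q.2| < e.
    have [q0|q0] := eqVneq q.2 0.
      by exists (e / 2); rewrite q0 subr0 gtr0_norm ?divr_gt0// gt_eqF ?divr_gt0//; split=> //; lra.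
    by exists q.2; rewrite subrr normr0.
  have : W° (patch m x (q.1, y)) by apply: eW; rewrite /square /= subrr normr0.
  by rewrite /patch /= (negbTE y0) => h; exists (sector (m x) x (q.1, y)) => //; rewrite sector_eq0.
have : nbhs q (bulk m @^-1` W) by apply/nbhs_bulk.
exact: ratpt_dense.
Qed.

Lemma prufer_separable : separable S.
Proof.
exists (range (fun q : rat * rat => bulk m (ratpt R q))); split.
  apply: (@sub_countable _ _ _ [set: rat * rat]); last exact: countableP.
  exact: card_image_le.
move=> O [p Op] oO; have [q Oq] := bulk_rational_dense (open_nbhs_nbhs (conj oO Op)).
by exists (bulk m (ratpt R q)); split => //; exists q.
Qed.

Lemma reals_uncountable : ~ countable [set: R].
Proof.
move=> cR; have c01 : countable (`[0%R, 1%R]%classic : set R).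
  by apply: sub_countable cR; exact: subset_card_le.
have := countable_lebesgue_measure0 c01.
by rewrite lebesgue_measure_itv /= lte01 oppr0 adde0 => /eqP; rewrite onee_eq0.
Qed.

(** If the ball of radius 2 / n around [axis x 0] lies in the patch at x and the
    ball of radius 1 / n contains the rational point q, then (n, q) determines x,
    since no patch contains two of the points [axis x 0]. *)
Lemma prufer_not_metrisable : ~ metrisable R S.
Proof.
move=> [N [f [g [fg gf cf0 cg0]]]].
have cf : continuous f by exact/continuous_subspace_setT.
have cg : continuous g by exact/continuous_subspace_setT.
have key x : exists kq : nat * (rat * rat),
    ball (f (axis m x 0)) (2 * kq.1.+1%:R^-1) `<=` g @^-1` range (patch m x) /\
    ball (f (axis m x 0)) (kq.1.+1%:R^-1) (f (bulk m (ratpt R kq.2))).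
  have : nbhs (f (axis m x 0)) (g @^-1` range (patch m x)).
    have := cg (f (axis m x 0)) (range (patch m x)); rewrite (fg _ I).2; apply.
    apply: open_nbhs_nbhs; split; first exact: open_range_patch.
    by exists (0, 0) => //; rewrite patch_axis.
  move=> /nbhs_ballP[e /= e0 eU].
  have [k ke] : exists k : nat, 2 * k.+1%:R^-1 < e.
    exists (Num.bound (2 / e)); rewrite ltr_pdivrMr// -ltr_pdivrMl// mulrC.
    apply: (lt_trans (archi_boundP _)); first by rewrite divr_ge0// ltW.
    by rewrite ltr_nat.
  have : nbhs (axis m x 0) (f @^-1` ball (f (axis m x 0)) (k.+1%:R^-1)).
    by have := cf (axis m x 0) (ball (f (axis m x 0)) k.+1%:R^-1); apply;
      apply: nbhsx_ballx; rewrite invr_gt0.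
  move=> /bulk_rational_dense[q hq]; exists (k, q); split => //.
  by move=> z zb; apply: eU; exact: le_ball (ltW ke) _ zb.
have [h hP] := choice key.
apply: reals_uncountable; apply/countable_injP.
exists (pickle \o h) => x x' _ _ /= /(pcan_inj pickleK) E.
have [hx bx] := hP x; have [_] := hP x'; rewrite -E => /ball_sym bx'.
have := ball_triangle bx bx'; rewrite -mulr2n -(mulr_natl _ 2) => /hx /=.
rewrite (fg _ I).2 => /axis_in_range //.
Qed.

(** Finitely many patches cover [K], and each contains one point [axis x 0]. *)
Lemma compact_misses_axis (K : set S) (x_ : nat -> R) : compact K -> injective x_ ->
  exists k, ~ K (axis m (x_ k) 0).
Proof.
move=> cK xinj; apply/not_existsP => /= all_K.
have [D _ KD] : finite_subset_cover setT (fun x => range (patch m x)) K.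
  move: cK; rewrite compact_cover; apply=> [x _|p _]; first exact: open_range_patch.
  by exists (foot p).1 => //; exists (unpatch (foot p).1 p) => //; exact: patch_foot.
have xD k : [set` D] (x_ k).
  have [x xD /axis_in_range ->//] := KD _ (contrapT (all_K k)).
have := @infinite_nat; apply.
apply: (@sub_finite_set _ _ (x_ @^-1` [set` D])); first by move=> k _; exact: xD k.
by apply: finite_preimage; [move=> a b _ _; exact: xinj|exact: finite_fset].
Qed.

End prufer_topology.

(** * The long ray *)

Lemma nbhs_set_type (X : topologicalType) (A : set X) (x : A) (V : set A) : nbhs x V ->
  exists O : set X, [/\ open O, O (set_val x) & set_val @^-1` O `<=` V].
Proof. by case=> _ [[W oW <-] Wx WV]; exists W. Qed.

Section long_ray.
Variable R : realType.
Local Notation cray := (closed_long_ray R).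
Local Notation oray := (open_long_ray R).
Local Open Scope order_scope.

Lemma cray_leE (w w' : omega1) (s s' : ico01 R) :
  ((w, s) <= (w', s') :> cray) = (w <= w') && ((w' <= w) ==> (s <= s')).
Proof. by []. Qed.

(** The least first coordinate of an upper bound, followed by the infimum of the
    second coordinates that go with it. *)
Lemma cray_sup (A : set cray) : (exists u, ubound A u) ->
  exists2 u, ubound A u & forall v, ubound A v -> u <= v.
Proof.
move=> [[w0 s0] ub0].
have [|w [s ubws] wmin] := @omega1_wf [set w | exists s, ubound A ((w, s) : cray)].
  by exists w0, s0.
pose T := [set r : R | exists2 s : ico01 R, val s = r & ubound A ((w, s) : cray)].
have T0 : T !=set0 by exists (val s), s.
have lT : lbound T 0%R by move=> _ [s' <- _]; have /andP[] := valP s'.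
have iT : has_inf T by split => //; exists 0%R.
have r0 : (0 <= inf T)%R by apply: lb_le_inf.
have rs : (inf T <= val s)%R by apply: ge_inf; [exists 0%R|exists s].
have r01 : (0 <= inf T < 1)%R.
  by rewrite r0 /=; apply: le_lt_trans rs _; have /andP[] := valP s.
exists ((w, exist _ (inf T) r01) : cray).
  move=> [w' s'] Aws; have := ubws _ Aws; rewrite !cray_leE => /andP[-> /= _].
  apply/implyP => ww'; apply: lb_le_inf => // _ [t <- ubt].
  by have := ubt _ Aws; rewrite cray_leE => /andP[_ /implyP]; apply.
move=> [w' s'] ub'; rewrite cray_leE; apply/andP; split; first by apply: wmin; exists s'.
apply/implyP => w'w; apply: ge_inf; first by exists 0%R.
exists s' => //; suff -> : w = w' by [].
by apply/eqP; rewrite eq_le w'w andbT; apply: wmin; exists s'.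
Qed.

Lemma ico01_0P : (0 <= (0 : R) < 1)%R.
Proof. by rewrite lexx ltr01. Qed.

Lemma omega1_above (w_ : nat -> omega1) : exists w, forall n, w_ n < w.
Proof.
apply: contrapT => H; apply: omega1_uncountable.
have -> : [set: omega1] = \bigcup_(n in [set: nat]) [set y | y <= w_ n].
  apply/seteqP; split => // y _; apply: contrapT => Hy; apply: H; exists y => n.
  by rewrite ltNge; apply/negP => yn; apply: Hy; exists n.
by apply: bigcup_countable => // n _; exact: omega1_countable.
Qed.

Lemma cray_bounded (a_ : nat -> cray) : exists u, forall n, a_ n <= u.
Proof.
have [w wP] := omega1_above (fun n => (a_ n).1).
exists ((w, exist _ 0%R ico01_0P) : cray) => n.
have := wP n; case: (a_ n) => w' s' /= ww'; rewrite cray_leE (ltW ww') /=.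
by rewrite leNgt ww'.
Qed.

Lemma oray_up (x : oray) (u : cray) : set_val x <= u -> exists z : oray, set_val z = u.
Proof.
move=> xu; have nu : ~ forall y, u <= y.
  move=> umin; have /set_mem := valP x; apply => y.
  exact: le_trans (umin y).
by exists (exist _ u (mem_set nu)).
Qed.

Lemma oray_bounded (x_ : nat -> oray) : exists u : oray, forall n, set_val (x_ n) <= set_val u.
Proof.
have [u uP] := cray_bounded (fun n => set_val (x_ n)).
by have [z zu] := oray_up (uP 0); exists z => n; rewrite zu.
Qed.

(** The supremum is the limit: everything below it is exceeded by a term of the
    sequence. *)
Lemma oray_cvg (x_ : nat -> oray) : (forall n, set_val (x_ n) <= set_val (x_ n.+1)) ->
  exists2 z : oray, (forall n, set_val (x_ n) <= set_val z) & x_ n @[n --> \oo] --> z.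
Proof.
move=> xS; have [b bP] := oray_bounded x_.
have [|u ub ulub] := @cray_sup (range (fun n => set_val (x_ n))).
  by exists (set_val b) => _ [n _ <-].
have xu n : set_val (x_ n) <= u by apply: ub; exists n.
have [z zu] := oray_up (xu 0); exists z => [n|]; first by rewrite zu.
move=> V /nbhs_set_type[W [oW Wz WV]].
have : nbhs (set_val z : cray) W by exact: open_nbhs_nbhs.
rewrite itv_nbhsE zu => -[[l r] [/= lr_open /andP[lu ur]] lrW].
have mono n k : set_val (x_ n) <= set_val (x_ (n + k)%N).
  by elim: k => [|k IH]; [rewrite addn0|rewrite addnS; exact: le_trans (xS _)].
have [N lN] : exists N, forall n, (N <= n)%N -> (l <= BLeft (set_val (x_ n)))%O.
  case: l lr_open lu {lrW} => [[] l|[] ]; last by [].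
  - by case: r {ur} => [[] ?|[]].
  - move=> _ lu; have [N lN] : exists N, l < set_val (x_ N).
      apply: contrapT => H; have : u <= l.
        apply: ulub => _ [n _ <-]; rewrite leNgt; apply/negP => ln.
        by apply: H; exists n.
      by move: lu; rewrite bnd_simp ltNge => /negP ul /ul.
    exists N => n Nn; rewrite bnd_simp; apply: lt_le_trans lN _.
    by rewrite -(subnKC Nn).
  - by exists 0%N.
exists N => // n /= Nn; apply: WV; apply: lrW => /=; rewrite itv_boundlr lN//=.
apply: le_trans ur; rewrite bnd_simp; exact: xu.
Qed.

End long_ray.

(** * Squatness *)

Section squat.
Variable R : realType.
Local Notation cray := (closed_long_ray R).
Local Notation oray := (open_long_ray R).

Local Notation above a x := ((set_val (a : oray) <= set_val (x : oray))%O).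

Lemma oray_iterate (P : oray -> oray -> Prop) a :
  (forall x : oray, above a x -> exists2 y : oray, above x y & P x y) ->
  exists x_ : nat -> oray, forall n, [/\ above a (x_ n), above (x_ n) (x_ n.+1) & P (x_ n) (x_ n.+1)].
Proof.
move=> next; have nextT x : exists y : oray, above a x -> above x y /\ P x y.
  have [ax|nax] := pselect (above a x); last by exists x.
  by have [y xy Pxy] := next x ax; exists y.
have [h hP] := choice nextT.
exists (fun n => iter n h a) => n.
have an : above a (iter n h a).
  elim: n => [|n IH] /=; first exact: lexx.
  exact: le_trans IH (hP _ IH).1.
by have [] := hP _ an.
Qed.

(** Otherwise one finds an increasing sequence along which [g] jumps by at least
    e / 2 at each step; it converges, and [g] is continuous at its limit. *)
Lemma oray_small_oscillation (g : oray -> R) a e : 0 < e ->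
  (forall x : oray, above a x -> {for x, continuous g}) ->
  exists2 b : oray, above a b & forall x y : oray, above b x -> above b y -> `|g x - g y| <= e.
Proof.
move=> e0 cg; apply: contrapT => H.
have next x : above a x -> exists2 y : oray, above x y & e / 2 < `|g x - g y|.
  move=> ax; apply: contrapT => Hx; apply: H; exists x => // y z xy xz.
  have small t : above x t -> `|g x - g t| <= e / 2.
    by move=> xt; rewrite leNgt; apply/negP => bad; apply: Hx; exists t.
  rewrite -(subrKA (g x)) (le_trans (ler_normD _ _))// distrC.
  by have := small _ xy; have := small _ xz; lra.
have [x_ xP] := oray_iterate next.
have [|z xz xcvg] := @oray_cvg R x_; first by move=> n; have [] := xP n.
have az : above a z by apply: le_trans (xz 0%N); have [] := xP 0%N.
have e4 : 0 < e / 4 by rewrite divr_gt0.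
have near_z : \forall t \near z, `|g z - g t| < e / 4.
  have h : \forall t \near z, ball (g z) (e / 4) (g t).
    exact: (cg z az _ (nbhsx_ballx (g z) _ e4)).
  by apply: filterS h => t; rewrite -ball_normE.
have [N _ HN] := xcvg _ near_z.
have := HN N (leqnn N); have := HN N.+1 (leqnSn N) => /= h1 h2.
have [_ _] := xP N; apply/negP; rewrite -leNgt.
rewrite -(subrKA (g z)) (le_trans (ler_normD _ _))// (distrC _ (g z)).
by lra.
Qed.

(** Countably many thresholds, one for each 1 / (k + 1), have a common upper
    bound. *)
Lemma oray_eventually_constant (g : oray -> R) a :
  (forall x : oray, above a x -> {for x, continuous g}) ->
  exists2 b : oray, above a b & forall x : oray, above b x -> g x = g b.
Proof.
move=> cg; have H k : exists b : oray, above a b /\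
    forall x y : oray, above b x -> above b y -> `|g x - g y| <= k.+1%:R^-1.
  have k0 : 0 < k.+1%:R^-1 :> R by rewrite invr_gt0.
  by have [b ab bP] := oray_small_oscillation k0 cg; exists b.
have [b_ bP] := choice H.
have [b bB] := oray_bounded b_.
exists b; first exact: le_trans (bP 0%N).1 (bB 0%N).
move=> x bx; apply/eqP; rewrite -subr_eq0 -normr_le0; apply/ler_addgt0Pl => e e0.
rewrite addr0; pose k := Num.bound e^-1.
have := (bP k).2 x b (le_trans (bB k) bx) (bB k).
move/le_trans; apply; rewrite -[leRHS]invrK lef_pV2 ?posrE ?invr_gt0//.
apply: ltW; apply: (lt_le_trans (archi_boundP _)); first by rewrite invr_ge0 ltW.
by rewrite ler_nat.
Qed.

Lemma oray_nonempty : exists a : oray, True.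
Proof.
have [w _] : [set: omega1] !=set0.
  by apply/set0P/eqP => E; apply: omega1_uncountable; rewrite E; exact: countable0.
have h01 : 0 <= (1 / 2 : R) < 1 by apply/andP; split; lra.
pose u : cray := (w, exist _ (1 / 2) h01).
have nu : ~ forall y, (u <= y)%O.
  move=> /(_ ((w, exist _ 0 (ico01_0P R)) : cray)); rewrite cray_leE lexx /=.
  by move=> h; have : (1 / 2 : R) <= 0 by []; lra.
by exists (exist _ u (mem_set nu)).
Qed.

(** From some point on the projection to the plane is constant, so the map stays
    in one patch, where its coordinates are real functions. *)
Lemma prufer_squat m : squat R (prufer (R := R) m).
Proof.
move=> f cf; have [a0 _] := oray_nonempty.
have cfoot : continuous (@foot R m \o f).
  by move=> x; apply: continuous_comp; [exact: cf|exact: foot_continuous].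
have [a1 a01 h1] : exists2 b : oray, above a0 b & forall x : oray, above b x -> (foot (f x)).1 = (foot (f b)).1.
  apply: (@oray_eventually_constant (fun x => (foot (f x)).1)) => x _.
  by apply: (@continuous_comp _ _ _ (@foot R m \o f) fst); [exact: cfoot|exact: fst_continuous].
have [a2 a12 h2] : exists2 b : oray, above a1 b & forall x : oray, above b x -> (foot (f x)).2 = (foot (f b)).2.
  apply: (@oray_eventually_constant (fun x => (foot (f x)).2)) => x _.
  by apply: (@continuous_comp _ _ _ (@foot R m \o f) snd); [exact: cfoot|exact: snd_continuous].
pose q := foot (f a2).
have footE x : above a2 x -> foot (f x) = q.
  move=> a2x; rewrite [LHS]surjective_pairing h2// h1 ?(le_trans a12)//.
  by rewrite -(h1 a2 a12) -surjective_pairing.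
have fE x : above a2 x -> f x = patch m q.1 (unpatch q.1 (f x)).
  by move=> a2x; rewrite -(footE x a2x) patch_foot.
have [a3 a23 h3] : exists2 b : oray, above a2 b & forall x : oray, above b x -> (unpatch q.1 (f x)).1 = (unpatch q.1 (f b)).1.
  apply: (@oray_eventually_constant (fun x => (unpatch q.1 (f x)).1)) => x a2x.
  apply: (@continuous_comp _ _ _ (unpatch q.1 \o f) fst); last exact: fst_continuous.
  apply: continuous_comp; first exact: cf.
  by rewrite (fE x a2x); exact: unpatch_continuous.
have [a4 a34 h4] : exists2 b : oray, above a3 b & forall x : oray, above b x -> (unpatch q.1 (f x)).2 = (unpatch q.1 (f b)).2.
  apply: (@oray_eventually_constant (fun x => (unpatch q.1 (f x)).2)) => x a3x.
  have a2x := le_trans a23 a3x.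
  apply: (@continuous_comp _ _ _ (unpatch q.1 \o f) snd); last exact: snd_continuous.
  apply: continuous_comp; first exact: cf.
  by rewrite (fE x a2x); exact: unpatch_continuous.
exists a4 => x a4x; have a3x := le_trans a34 a4x.
rewrite (fE x (le_trans a23 a3x)) (fE a4 (le_trans a23 a34)); congr (patch m _ _).
by rewrite [LHS]surjective_pairing h4// h3// -(h3 a4 a34) -surjective_pairing.
Qed.

End squat.

(** * The code of a foliation *)

Section flat_charts.
Variable R : realType.
Local Notation plane := (R * R)%type.

Definition flat (w : R * 'rV[R]_1) : plane := (w.1, w.2 ord0 ord0).

Definition unflat (z : plane) : R * 'rV[R]_1 := (z.1, \row_(j < 1) z.2).

Lemma flatK : cancel flat unflat.
Proof.
move=> [u v]; rewrite /flat /unflat /=; congr pair.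
by apply/rowP => j; rewrite mxE (ord1 j).
Qed.

Lemma unflatK : cancel unflat flat.
Proof. by move=> [u v]; rewrite /flat /unflat /= mxE. Qed.

Lemma flat_continuous : continuous flat.
Proof.
move=> w; apply: (@pair_continuous R _ (fun w : R * 'rV[R]_1 => w.1) (fun w => w.2 ord0 ord0)).
  exact: cvg_fst.
apply: (@continuous_comp (R * 'rV[R]_1)%type 'rV[R]_1 R snd (fun v : 'rV[R]_1 => v ord0 ord0)).
  exact: cvg_snd.
exact: coord_continuous.
Qed.

Lemma unflat_continuous : continuous unflat.
Proof.
move=> z; have c2 : {for z, continuous (fun z : plane => \row_(j < 1) z.2)}.
  apply: matrix_continuous => i j.
  rewrite (_ : (fun y => _) = snd); first exact: snd_continuous.
  by apply/funext => y; rewrite mxE.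
exact: (@cvg_pair _ _ _ (nbhs z) (nbhs z.1) (nbhs (\row_(j < 1) z.2)) _ _ _ fst _ (@fst_continuous R z) c2).
Qed.

Lemma open_box_open (B : set (R * 'rV[R]_1)) : open_box B -> open B.
Proof.
move=> [I [J [oI oJ ->]]].
rewrite (_ : [set p | _] = [set p : R * 'rV[R]_1 | p.1 \in I] `&`
    [set p : R * 'rV[R]_1 | p.2 ord0 ord0 \in J ord0]).
  apply: openI.
    apply: (@open_comp (R * 'rV[R]_1)%type R fst [set` I]); first by move=> w _; exact: cvg_fst.
    exact: itv_open_ends_open.
  apply: (@open_comp (R * 'rV[R]_1)%type R (snd \o flat) [set` J ord0]).
    move=> w _; apply: continuous_comp; [exact: flat_continuous|exact: snd_continuous].
  exact: itv_open_ends_open.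
apply/seteqP; split => w /= [h1 h2]; split => //.
by move=> j; rewrite (ord1 j).
Qed.

Lemma continuous_within_open (T U : topologicalType) (A : set T) (f : T -> U) x :
  open A -> {within A, continuous f} -> A x -> {for x, continuous f}.
Proof.
by move=> oA; rewrite continuous_open_subspace// => cf Ax; apply: cf; exact/mem_set.
Qed.

Lemma foliated_chart_continuous (M : topologicalType) (c : chart R 1 M) p :
  foliated_chart c -> chart_dom c p -> {for p, continuous c}.
Proof.
by move=> [od [B [oB [g [_ _ cc _]]]]] dp; exact: (continuous_within_open od cc).
Qed.

(** Shrinking the image of a foliated chart to a square around a given point. *)
Lemma foliated_chart_box (M : topologicalType) (c : chart R 1 M) p (W : set M) :
  foliated_chart c -> chart_dom c p -> nbhs p W ->
  exists r g, [/\ 0 < r, (forall p', chart_dom c p' -> g (flat (c p')) = p') &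
    forall z, square (flat (c p)) r z ->
      [/\ W (g z), chart_dom c (g z), flat (c (g z)) = z & {for z, continuous g}]].
Proof.
move=> [od [B [/open_box_open oB [g [cB gB cc cg]]]]] dp nW.
have Bp := (cB _ dp).1.
have cgp := continuous_within_open oB cg Bp.
have nU : nbhs (flat (c p)) (unflat @^-1` (B `&` g @^-1` W)).
  apply: unflat_continuous; rewrite flatK; apply: filterI; first exact: open_nbhs_nbhs.
  by apply: cgp; rewrite (cB _ dp).2.
have /nbhs_squareP[r r0 rU] := nU.
exists r, (g \o unflat); split => // [p' dp'|z /rU[Bz Wz]].
  by rewrite /= flatK (cB _ dp').2.
have [dz cz] := gB _ Bz; split => //=; first by rewrite cz unflatK.
apply: continuous_comp; first exact: unflat_continuous.
exact: continuous_within_open cg Bz.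
Qed.

End flat_charts.

Section foliation_code.
Variables (R : realType) (m : R -> bool * bool) (K : set (prufer m)).
Hypothesis cK : compact K.
Local Notation plane := (R * R)%type.
Local Notation S := (prufer m).
Local Notation M := (set_type (~` K)).
Variables (F : foliation R 2 M) (p0 : M).
Implicit Types (c : chart R 1 M) (p : M) (s : S) (b : rat * rat * rat).

(** The point [p0] only makes this function total. *)
Definition into_complement s : M :=
  if pselect (~ K s) is left h then exist _ s (mem_set h) else p0.
Local Notation j := into_complement.

Lemma into_complementK s : ~ K s -> set_val (j s) = s.
Proof. by rewrite /j; case: pselect. Qed.

Lemma set_valK p : j (set_val p) = p.
Proof.
have h : ~ K (set_val p) by apply: (set_mem (valP p)).
by apply: val_inj; exact: into_complementK.
Qed.

Lemma complement_open : open (~` K).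
Proof. by apply: closed_openC; apply: compact_closed => //; exact: prufer_hausdorff. Qed.

Lemma into_complement_continuous s : ~ K s -> {for s, continuous j}.
Proof.
move=> Ks V /nbhs_set_type[W [oW]]; rewrite into_complementK// => Ws WV.
have : nbhs s (W `&` ~` K).
  by apply: filterI; apply: open_nbhs_nbhs => //; split => //; exact: complement_open.
apply: filterS => t [Wt Kt]; apply: WV.
by rewrite /= into_complementK.
Qed.

Lemma set_val_continuous : continuous (set_val : M -> S).
Proof. exact: initial_continuous. Qed.

(** Changes between charts of the foliation preserve plaques in both directions. *)
Lemma chart_near c p c' : atlas F c -> atlas F c' -> chart_dom c p -> chart_dom c' p ->
  \forall p' \near p, (flat (c p')).2 = (flat (c p)).2 <-> (flat (c' p')).2 = (flat (c' p)).2.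
Proof.
move=> Fc Fc' cp c'p.
have flatE (w w' : R * 'rV[R]_1) : (flat w).2 = (flat w').2 -> w.2 = w'.2.
  by move=> E; apply/rowP => k; rewrite (ord1 k).
have [f [g fg]] := atlas_change Fc Fc' cp c'p.
have [f' [g' fg']] := atlas_change Fc' Fc c'p cp.
have E := nbhs_singleton fg; have E' := nbhs_singleton fg'.
apply: filterS2 fg fg' => p' /= Ep Ep'; split => /flatE h; rewrite /flat /=.
  by rewrite Ep E /= h.
by rewrite Ep' E' /= h.
Qed.

(** Boxes of the upper half-plane contained in the domain of a chart of the
    foliation; on such a box the chart provides a height. *)
Definition subordinate b c := atlas F c /\
  forall h, ratbox b h -> [/\ 0 < h.2, ~ K (bulk m h) & chart_dom c (j (bulk m h))].

Definition height c (h : plane) : R := (flat (c (j (bulk m h)))).2.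

Lemma height_no_extremum b c : subordinate b c -> no_extremum (ratbox b) (height c).
Proof.
move=> [Fc bc] h bh; have [h0 Kh dh] := bc _ bh.
have hn : h.2 != 0 by rewrite gt_eqF.
have fc := atlas_chart Fc.
have cj : {for h, continuous (j \o bulk m)}.
  by apply: continuous_comp; [exact: bulk_continuous|exact: into_complement_continuous].
split.
  rewrite (_ : height c = snd \o (@flat R \o (c \o (j \o bulk m))))//.
  apply: continuous_comp; last exact: snd_continuous.
  apply: continuous_comp; last exact: flat_continuous.
  by apply: continuous_comp => //; exact: foliated_chart_continuous.
move=> W nW; pose U : set M := [set p | W (foot (set_val p)) /\ (foot (set_val p)).2 != 0].
have hE : foot (set_val (j (bulk m h))) = h by rewrite into_complementK// foot_bulk.
have nU : nbhs (j (bulk m h)) U.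
  have cf : {for j (bulk m h), continuous (@foot R m \o set_val)}.
    by apply: continuous_comp; [exact: set_val_continuous|exact: foot_continuous].
  have nb : nbhs (foot (set_val (j (bulk m h)))) [set t | W t /\ t.2 != 0].
    by rewrite hE; apply: filterI => //; exact: snd_neq0_near.
  exact: (cf _ nb).
have [r [g [r0 _ gP]]] := foliated_chart_box fc dh nU.
set z := flat _ in gP.
have lift y : `|y - z.2| < r -> exists2 h', W h' & height c h' = y.
  move=> yr; have [|[Wg gn] _ gE _] := gP (z.1, y); first by rewrite /square /= subrr normr0.
  exists (foot (set_val (g (z.1, y)))) => //.
  rewrite /height (_ : bulk m _ = set_val (g (z.1, y))) ?set_valK ?gE//.
  exact: bulk_foot.
split.
  have [|h' Wh' E] := lift (z.2 + r / 2).
    by rewrite addrAC subrr add0r gtr0_norm; lra.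
  by exists h' => //; rewrite E /height -/z; lra.
have [|h' Wh' E] := lift (z.2 - r / 2).
  by rewrite addrAC subrr add0r normrN gtr0_norm; lra.
by exists h' => //; rewrite E /height -/z; lra.
Qed.

(** The code records, for each subordinate box, the order of the heights at
    rational points in one chosen chart.  A chart around [axis x 0] belongs to
    the same foliation, so it is compatible with this code. *)
Lemma foliation_extends : exists C, forall x, ~ K (axis m x 0) -> extends C x (m x).
Proof.
have key b : exists c, (exists c', subordinate b c') -> subordinate b c.
  have [[c bc]|nb] := pselect (exists c, subordinate b c); first by exists c.
  by have [c _] := atlas_cover F p0; exists c.
have [ch chP] := choice key.
exists [set i | (exists c, subordinate i.1.1 c) /\
  height (ch i.1.1) (ratpt R i.1.2) <= height (ch i.1.1) (ratpt R i.2)] => x Kx.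
set C := [set i | _].
have codedC b : (exists c, subordinate b c) -> coded C b (height (ch b)).
  by move=> bc p1 p2 b1 b2; rewrite /C /=; split => [[]|].
pose px := j (axis m x 0).
have [c [Fc dc]] := atlas_cover F px.
have fc := atlas_chart Fc.
pose U : set M := [set p | range (patch m x) (set_val p)].
have nU : nbhs px U.
  apply: set_val_continuous; rewrite into_complementK//; apply: open_nbhs_nbhs; split.
    exact: open_range_patch.
  by exists (0, 0) => //; rewrite patch_axis.
have [r [g [r0 gK gP]]] := foliated_chart_box fc dc nU.
set z := flat _ in gP.
(* The chart c read in the patch at x and cut down to the preimage of a square,
   as [box_chart] asks for. *)
pose N : set plane := [set q | [/\ ~ K (patch m x q), chart_dom c (j (patch m x q)) &
  square z r (flat (c (j (patch m x q))))]].
pose cN q := flat (c (j (patch m x q))).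
have cj q : ~ K (patch m x q) -> {for q, continuous (j \o patch m x)}.
  by move=> Kq; apply: continuous_comp; [exact: patch_continuous|exact: into_complement_continuous].
have ccN q : N q -> {for q, continuous cN}.
  move=> [Kq dq _]; rewrite (_ : cN = @flat R \o (c \o (j \o patch m x)))//.
  apply: continuous_comp; last exact: flat_continuous.
  by apply: continuous_comp; [exact: cj|exact: foliated_chart_continuous].
have oN : open N.
  rewrite openE => q Nq; have [Kq dq sq] := Nq.
  have n1 : nbhs q [set t | ~ K (patch m x t)].
    have h1 : nbhs (patch m x q) (~` K) by apply: open_nbhs_nbhs; split => //; exact: complement_open.
    exact: (@patch_continuous R m x q _ h1).
  have n2 : nbhs q [set t | chart_dom c (j (patch m x t))].
    have h2 : nbhs (j (patch m x q)) (chart_dom c) by apply: open_nbhs_nbhs; split => //; exact: fc.1.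
    exact: (cj q Kq _ h2).
  have n3 : nbhs q [set t | square z r (cN t)].
    have h3 : nbhs (cN q) (square z r) by apply: open_nbhs_nbhs; split => //; exact: square_open.
    exact: (ccN q Nq _ h3).
  by rewrite /interior; apply: filterS3 n1 n2 n3.
have N0 : N (0, 0).
  by split; rewrite patch_axis//; exact: square_center.
exists N, cN; split => //.
  split => //; exists (fun w => unpatch x (set_val (g w))), z, r; split => //.
  - move=> q [Kq dq sq]; split => //.
    by rewrite /cN gK// into_complementK// patchK.
  - move=> w wz; have [[q _ qE] dg gE _] := gP w wz.
    have pE : patch m x (unpatch x (set_val (g w))) = set_val (g w) by rewrite -qE patchK.
    rewrite /N /cN /= pE set_valK gE; split => //; split => //.
    exact: (set_mem (valP (g w))).
  - move=> w /gP[[q _ qE] _ _ cg].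
    apply: (@continuous_comp _ _ _ (set_val \o g) (unpatch x)).
      by apply: continuous_comp => //; exact: set_val_continuous.
    by rewrite /= -qE; exact: unpatch_continuous.
move=> q Nq q0; have [Kq dq sq] := Nq.
have qn : q.2 != 0 by rewrite gt_eqF.
pose h := sector (m x) x q.
have patchE (p : plane) : p.2 != 0 -> patch m x p = bulk m (sector (m x) x p).
  by rewrite /patch => /negbTE ->.
have hn : h.2 != 0 by rewrite sector_eq0.
exists [set h' | [/\ 0 < h'.2, ~ K (bulk m h') & chart_dom c (j (bulk m h'))]].
  have cjb : {for h, continuous (j \o bulk m)}.
    apply: continuous_comp; first exact: bulk_continuous.
    by apply: into_complement_continuous; rewrite -patchE.
  have n1 : nbhs h [set t | 0 < t.2].
    by apply: (@cvg_above R _ snd h 0 (@snd_continuous R h)); rewrite sector_gt0.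
  have n2 : nbhs h [set t | ~ K (bulk m t)].
    have h2 : nbhs (bulk m h) (~` K).
      by apply: open_nbhs_nbhs; split; [exact: complement_open|rewrite /= -patchE].
    exact: (bulk_continuous hn h2).
  have n3 : nbhs h [set t | chart_dom c (j (bulk m t))].
    have h3 : nbhs (j (bulk m h)) (chart_dom c).
      by apply: open_nbhs_nbhs; split; [exact: fc.1|rewrite -patchE].
    exact: (cjb _ h3).
  by apply: filterS3 n1 n2 n3.
move=> b bh bW; have sb : exists c, subordinate b c by exists c; split.
have bch := chP b sb.
exists (height (ch b)); split; [exact: height_no_extremum|exact: codedC|].
have n1 : \forall p \near q, ratbox b (sector (m x) x p).
  exact: (@sector_continuous R (m x) x q _ (nbhs_ratbox bh)).
have n2 := snd_neq0_near qn.
have dch : chart_dom (ch b) (j (patch m x q)) by rewrite patchE//; have [] := bch.2 _ bh.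
have n3 := cj q Kq _ (chart_near Fc bch.1 dq dch).
apply: filterS3 n1 n2 n3 => p b1 p0' E; split => //.
by rewrite /cN /height -!patchE.
Qed.

End foliation_code.

(** * Choice of the modes *)

Section ternary.
Variable R : realType.
Implicit Types (D : nat -> bool) (n k : nat).

Definition ternary_sum D n : R := \sum_(i < n) (D i)%:R * 3^-1 ^+ i.

(** Reading sequences of bits as ternary expansions without the digit 2 makes
    them real numbers injectively. *)
Definition ternary D : R := sup (range (ternary_sum D)).

Lemma ternary_sumS D n : ternary_sum D n.+1 = ternary_sum D n + (D n)%:R * 3^-1 ^+ n.
Proof. by rewrite /ternary_sum big_ord_recr. Qed.

Lemma ternary_sum_tail D n k :
  ternary_sum D (n + k) <= ternary_sum D n + 3 / 2 * 3^-1 ^+ n.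
Proof.
suff : ternary_sum D (n + k) + 3 / 2 * 3^-1 ^+ (n + k) <= ternary_sum D n + 3 / 2 * 3^-1 ^+ n.
  by apply: le_trans; rewrite lerDl mulr_ge0// exprn_ge0.
elim: k => [|k IH]; first by rewrite addn0.
apply: le_trans IH; rewrite addnS ternary_sumS exprS.
have : 0 <= (3^-1 : R) ^+ (n + k) by rewrite exprn_ge0.
by move: (3^-1 ^+ _) => e e0; case: (D _) => /=; lra.
Qed.

Lemma ternary_sum_mono D n k : ternary_sum D n <= ternary_sum D (n + k).
Proof.
elim: k => [|k IH]; first by rewrite addn0.
by rewrite addnS ternary_sumS (le_trans IH)// lerDl mulr_ge0// exprn_ge0.
Qed.

Lemma ternary_sup D : has_sup (range (ternary_sum D)).
Proof.
split; first by exists (ternary_sum D 0), 0%N.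
exists (ternary_sum D 0 + 3 / 2 * 3^-1 ^+ 0) => _ [n _ <-].
by have := ternary_sum_tail D 0 n.
Qed.

(** At the first difference the digit 1 outweighs all later digits together,
    which sum to at most half of it. *)
Lemma ternary_lt D D' n : (forall i, (i < n)%N -> D i = D' i) -> ~~ D n -> D' n ->
  ternary D < ternary D'.
Proof.
move=> E nD D'n; have p0 : 0 < (3^-1 : R) ^+ n by rewrite exprn_gt0.
have sE : ternary_sum D n = ternary_sum D' n.
  by apply: eq_bigr => i _; rewrite E.
have up : ternary D <= ternary_sum D n + 1 / 2 * 3^-1 ^+ n.
  apply: ge_sup; first by exists (ternary_sum D 0), 0%N.
  move=> _ [k _ <-]; rewrite (le_trans (ternary_sum_mono D k n.+1))// addnC.
  apply: (le_trans (ternary_sum_tail D n.+1 k)).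
  by rewrite ternary_sumS (negbTE nD) exprS /= mul0r; lra.
have lo : ternary_sum D' n.+1 <= ternary D'.
  by apply: ub_le_sup; [exact: (ternary_sup D').2|exists n.+1].
by move: lo; rewrite ternary_sumS D'n -sE /= mul1r; lra.
Qed.

Lemma ternary_inj : injective ternary.
Proof.
move=> D D' E; apply: contrapT => DD'.
have ex : exists n, D n != D' n.
  by apply: contrapT => H; apply: DD'; apply/funext => n; apply/eqP/negPn/negP => h; apply: H; exists n.
case: (ex_minnP ex) => n dn nmin.
have Ei i : (i < n)%N -> D i = D' i.
  by move=> i_n; apply/eqP/negPn/negP => /nmin; rewrite leqNgt i_n.
case Dn : (D n); case D'n : (D' n); move: dn; rewrite Dn D'n// => _.
  by have := @ternary_lt D' D n (fun i h => esym (Ei i h)) (negbT D'n) Dn; rewrite E ltxx.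
by have := @ternary_lt D D' n Ei (negbT Dn) D'n; rewrite E ltxx.
Qed.

Definition bits_point (T : countType) (D : T -> bool) : R :=
  ternary (fun n => oapp D false (unpickle n)).

Lemma bits_point_inj (T : countType) : injective (@bits_point T).
Proof.
move=> D D' /ternary_inj E; apply/funext => i.
by have := congr1 (fun f => f (pickle i)) E; rewrite pickleK.
Qed.

Definition code_point (Ck : set code_index * nat) : R :=
  bits_point (fun i : rat * rat * rat * (rat * rat) * (rat * rat) + nat =>
    match i with inl i => `[< Ck.1 i >] | inr k => k == Ck.2 end).

Lemma code_point_inj : injective code_point.
Proof.
move=> [C k] [C' k'] /bits_point_inj E; congr pair; last first.
  by have /= := congr1 (@^~ (inr k)) E; rewrite eqxx => /esym/eqP.
apply/funext => i; apply/propext.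
have /= Ei := congr1 (@^~ (inl i)) E.
by split=> /asboolP; [rewrite Ei|rewrite -Ei] => /asboolP.
Qed.

End ternary.

Local Close Scope ring_scope.

Theorem theorem1p1 (R : realType) :
  exists S : topologicalType,
    [/\ surface R S, separable S, squat R S, ~ metrisable R S &
        forall K : set S, compact K ->
          ~ admits_foliation R 2 (set_type (~` K))].
Proof.
have diag (x : R) : exists mu, forall C k, x = code_point R (C, k) -> ~ extends C x mu.
  have [[C [k xE]]|nx] := pselect (exists C k, x = code_point R (C, k)); last first.
    by exists (false, false) => C k xE; case: nx; exists C, k.
  have [mu muP] : exists mu, ~ extends C x mu.
    apply: contrapT => /forallNP H.
    by apply: (@not_all_extend R C x); apply: contrapT; exact: H.
  exists mu => C' k' xE'; suff -> : C' = C by [].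
  by have [] := code_point_inj (etrans (esym xE') xE).
have [m mP] := choice diag.
exists (prufer m); split.
- split; [exact: prufer_hausdorff|exact: prufer_locally_euclidean|exact: prufer_connected].
- exact: prufer_separable.
- exact: prufer_squat.
- exact: prufer_not_metrisable.
move=> K cK [F].
have [k0 Kk0] : exists k : nat, (~` K) (axis m (k%:R)%R 0%R).
  by apply: compact_misses_axis => // a b /eqP; rewrite eqr_nat => /eqP.
have p0 : set_type (~` K) by exists (axis m (k0%:R)%R 0%R); exact: mem_set.
have [C CP] := foliation_extends cK F p0.
have [k Kk] : exists k, ~ K (axis m (code_point R (C, k)) 0%R).
  by apply: compact_misses_axis => // a b /code_point_inj[].
exact: mP erefl (CP _ Kk).
Qed.
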